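(* Let $k$ be an algebraically closed field and let $X$ be an algebraic variety over $k$ with an action of an algebraic group $G$. Suppose that $X = Y\sqcup U$ where $Y$ is a closed subvariety and $U$ is an open orbitwise-closed subvariety. Then, for any pseudo-quotient $\pi: X\to\overline{X}$, we have a decomposition $$\overline{X} = \pi(Y)\sqcup\pi(U),$$ where $\pi(U)\subseteq\overline{X}$ is open, $\pi(Y)\subseteq\overline{X}$ is closed, and the morphisms $\pi|_U: U\to\pi(U)$ and $\pi|_Y: Y\to\pi(Y)$ are pseudo-quotients. Furthermore, if $k$ has characteristic zero then, for any pseudo-quotients $Y\to\overline{Y}$ and $U\to\overline{U}$ for the action of $G$, we have $[\overline{X}] = [\overline{Y}] + [\overline{U}]$ in the Grothendieck ring of algebraic varieties $\mathrm{K}\mathbf{Var}_k$.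
   Context: Pseudo-quotient: a surjective $G$-invariant regular morphism $\pi: X\to Y$ onto a variety such that for any disjoint $G$-invariant closed sets $W_1,W_2\subseteq X$ one has $\overline{\pi(W_1)}\cap\overline{\pi(W_2)}=\emptyset$. A subset $A\subseteq X$ is orbitwise-closed if $\overline{Ga}\subseteq A$ for every $a\in A$. $\mathrm{K}\mathbf{Var}_k$ is the commutative ring generated by isomorphism classes $[X]$ of varieties over $k$ modulo $[X]=[Y]+[X-Y]$ for $Y\subseteq X$ closed, with product induced by the cartesian product. Varieties are not assumed irreducible. *)

(* Defs.v *)
From HB Require Import structures.
From mathcomp Require Import all_boot all_order all_algebra.
From mathcomp Require Import all_classical.
From mathcomp Require Import topology.
From mathcomp Require Import -(notations) mpoly.

Set Implicit Arguments.
Unset Strict Implicit.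
Unset Printing Implicit Defensive.

Import GRing.Theory.
Local Open Scope classical_set_scope.
Local Open Scope ring_scope.

(* Varieties are treated in the classical way, as spaces with functions:
   reduced separated schemes of finite type over the algebraically closed
   field k, seen through their closed points.  The sheaf of regular functions
   is recorded by its germs: [regular_at x f] says that f is regular on some
   open neighbourhood of x, so that a section over an open set U is a function
   regular at every point of U.  A function is always total on the carrier, and
   its values away from x are irrelevant by [regular_at_near]. *)
Record fspace (k : closedFieldType) := FSpace {
  fcarrier :> topologicalType;
  regular_at : fcarrier -> (fcarrier -> k) -> Prop;
  regular_at_near : forall x f g,
    (\forall y \near x, f y = g y) -> regular_at x f -> regular_at x g;
  regular_at_open : forall x f,
    regular_at x f -> \forall y \near x, regular_at y f;
  regular_at_cst : forall x (c : k), regular_at x (fun=> c);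
  regular_atD : forall x f g,
    regular_at x f -> regular_at x g -> regular_at x (fun y => f y + g y);
  regular_atM : forall x f g,
    regular_at x f -> regular_at x g -> regular_at x (fun y => f y * g y)
}.

Definition fmorphism (k : closedFieldType) (X Y : fspace k) (f : X -> Y) :
    Prop :=
  continuous f /\
  forall x (h : Y -> k), regular_at (f x) h -> regular_at x (h \o f).

Definition fiso (k : closedFieldType) (X Y : fspace k) : Prop :=
  exists (f : X -> Y) (g : Y -> X),
    [/\ fmorphism f, fmorphism g, cancel f g & cancel g f].

Section Subspace.
Context (k : closedFieldType) (X : fspace k) (A : set X).

Definition sub_regular_at (a : A) (f : A -> k) : Prop :=
  exists2 g : X -> k, regular_at (val a) g & \forall b \near a, f b = g (val b).

Fact sub_near (a : A) (P : X -> Prop) :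
  (\forall x \near val a, P x) -> \forall b \near a, P (val b).
Proof. by move=> aP; exact: (@initial_continuous _ _ (@set_val X A) a). Qed.

Fact sub_regular_at_near a f g : (\forall y \near a, f y = g y) ->
  sub_regular_at a f -> sub_regular_at a g.
Proof.
move=> fg [h ah fh]; exists h => //.
by apply: filterS2 fg fh => b <-.
Qed.

Fact sub_regular_at_open a f :
  sub_regular_at a f -> \forall b \near a, sub_regular_at b f.
Proof.
move=> [g ag fg].
have H1 := sub_near (regular_at_open ag); have H2 := near_join fg.
by apply: filterS2 H1 H2 => b bg fb; exists g; [exact: bg | exact: fb].
Qed.

Fact sub_regular_at_cst a (c : k) : sub_regular_at a (fun=> c).
Proof. exists (fun=> c); first exact: regular_at_cst.
exact: filterE. Qed.

Fact sub_regular_atD a f g : sub_regular_at a f -> sub_regular_at a g ->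
  sub_regular_at a (fun b => f b + g b).
Proof.
move=> [f' af ff] [g' ag gg]; exists (fun x => f' x + g' x).
  exact: regular_atD.
by apply: filterS2 ff gg => b -> ->.
Qed.

Fact sub_regular_atM a f g : sub_regular_at a f -> sub_regular_at a g ->
  sub_regular_at a (fun b => f b * g b).
Proof.
move=> [f' af ff] [g' ag gg]; exists (fun x => f' x * g' x).
  exact: regular_atM.
by apply: filterS2 ff gg => b -> ->.
Qed.

(* The induced (reduced) structure; used for open and for closed subsets. *)
Definition subfspace : fspace k :=
  @FSpace k (set_type A) sub_regular_at sub_regular_at_near sub_regular_at_open
    sub_regular_at_cst sub_regular_atD sub_regular_atM.

End Subspace.

Section AffineSpace.
Context (k : closedFieldType) (n : nat).

Definition aff : Type := 'rV[k]_n.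

HB.instance Definition _ := Choice.on aff.

Definition peval (p : mpoly n k) (x : aff) : k :=
  meval (fun i => (x : 'rV[k]_n) ord0 i) p.

Definition zeros (S : set (mpoly n k)) : set aff :=
  [set x | forall p, S p -> peval p x = 0].

Definition zariski_open (U : set aff) : Prop := exists S, U = ~` zeros S.

Fact zariski_openP U : zariski_open U <->
  (forall x, U x -> exists2 p, peval p x != 0 & [set y | peval p y != 0] `<=` U).
Proof.
split=> [[S ->] x|UP].
  move=> /existsNP[p /not_implyP[Sp /eqP px]]; exists p => //.
  by move=> y /= /eqP py /(_ p Sp).
exists [set p | [set y | peval p y != 0] `<=` U].
apply/seteqP; split=> x.
  by move=> /UP[p px pU] /(_ p pU)/eqP; rewrite (negbTE px).
by move=> /existsNP[p /not_implyP[pU /eqP px]]; exact: pU.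
Qed.

Fact zariski_openT : zariski_open setT.
Proof.
apply/zariski_openP => x _; exists 1 => //.
by rewrite /peval meval1 oner_neq0.
Qed.

Fact zariski_openI : setI_closed zariski_open.
Proof.
move=> U V /zariski_openP oU /zariski_openP oV; apply/zariski_openP => x [Ux Vx].
have [p px pU] := oU _ Ux; have [q qx qV] := oV _ Vx.
exists (p * q); first by rewrite /peval mevalM mulf_neq0.
move=> y /=; rewrite /peval mevalM mulf_eq0 negb_or => /andP[py qy].
by split; [exact: pU | exact: qV].
Qed.

Fact zariski_open_bigU (I : Type) (f : I -> set aff) :
  (forall i, zariski_open (f i)) -> zariski_open (\bigcup_i f i).
Proof.
move=> of_; apply/zariski_openP => x [i _ fx].
have /zariski_openP/(_ x fx)[p px pf] := of_ i.
by exists p => // y /pf fy; exists i.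
Qed.

HB.instance Definition _ := isOpenTopological.Build aff
  zariski_openT zariski_openI zariski_open_bigU.

Lemma zariskiE (U : set aff) : open U <-> zariski_open U.
Proof. by []. Qed.

Definition aff_regular_at (x : aff) (f : aff -> k) : Prop :=
  exists p q, peval q x != 0 /\ \forall y \near x, f y = peval p y / peval q y.

Fact near_neq0 (p : mpoly n k) x :
  peval p x != 0 -> \forall y \near (x : aff), peval p y != 0.
Proof.
move=> px; apply: (open_nbhs_nbhs (A := [set y | peval p y != 0])).
split=> //; apply/zariski_openP => y py; by exists p.
Qed.

Fact aff_regular_at_near x f g : (\forall y \near x, f y = g y) ->
  aff_regular_at x f -> aff_regular_at x g.
Proof.
move=> fg [p [q [qx fE]]]; exists p, q; split => //.
by apply: filterS2 fg fE => y <-.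
Qed.

Fact aff_regular_at_open x f :
  aff_regular_at x f -> \forall y \near x, aff_regular_at y f.
Proof.
move=> [p [q [qx fE]]].
have H1 := near_neq0 qx; have H2 := near_join fE.
by apply: filterS2 H1 H2 => y qy fy; exists p, q.
Qed.

Fact aff_regular_at_cst x (c : k) : aff_regular_at x (fun=> c).
Proof.
exists (mpolyC n c), 1; rewrite /peval meval1 oner_neq0; split=> //.
by apply: filterE => y; rewrite mevalC meval1 divr1.
Qed.

Fact aff_regular_atD x f g : aff_regular_at x f -> aff_regular_at x g ->
  aff_regular_at x (fun y => f y + g y).
Proof.
move=> [p [q [qx fE]]] [r [s [sx gE]]]; exists (p * s + r * q), (q * s).
split; first by rewrite /peval mevalM mulf_neq0.
have qsx : peval (q * s) x != 0 by rewrite /peval mevalM mulf_neq0.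
apply: filterS3 fE gE (near_neq0 qsx) => y -> ->.
rewrite /peval mevalM mulf_eq0 negb_or => /andP[qy sy].
by rewrite addf_div // mevalD !mevalM.
Qed.

Fact aff_regular_atM x f g : aff_regular_at x f -> aff_regular_at x g ->
  aff_regular_at x (fun y => f y * g y).
Proof.
move=> [p [q [qx fE]]] [r [s [sx gE]]]; exists (p * r), (q * s).
split; first by rewrite /peval mevalM mulf_neq0.
by apply: filterS2 fE gE => y -> ->; rewrite mulf_div /peval !mevalM.
Qed.

Definition affine_space : fspace k :=
  @FSpace k aff aff_regular_at aff_regular_at_near aff_regular_at_open
    aff_regular_at_cst aff_regular_atD aff_regular_atM.

End AffineSpace.

Section Product.
Context (k : closedFieldType) (X Y : fspace k).

(* An alias: X * Y itself canonically carries the product topology, which is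
   coarser than the topology of the product variety. *)
Definition fpair : Type := (X * Y)%type.

HB.instance Definition _ := Choice.on fpair.

(* The function (x, y) |-> \sum_i a_i(x) b_i(y), for s the list of (a_i, b_i). *)
Definition tens (s : seq ((X -> k) * (Y -> k))) (z : fpair) : k :=
  \sum_(ab <- s) ab.1 z.1 * ab.2 z.2.

Definition tens_regular_at (s : seq ((X -> k) * (Y -> k))) (z : fpair) : Prop :=
  forall ab, ab \in s -> regular_at z.1 ab.1 /\ regular_at z.2 ab.2.

Definition fpair_basic (U : set X) (V : set Y) (s : seq ((X -> k) * (Y -> k))) :
  set fpair := [set z | [/\ U z.1, V z.2 & tens s z != 0]].

(* Basic open sets: the nonvanishing loci, in products U x V of open sets, of
   sums of products of regular functions on U and on V. *)
Definition fpair_open (W : set fpair) : Prop :=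
  forall z, W z -> exists U V s,
    [/\ open U, open V, forall w, U w.1 -> V w.2 -> tens_regular_at s w,
        fpair_basic U V s z & fpair_basic U V s `<=` W].

Definition tens_mul (s t : seq ((X -> k) * (Y -> k))) :=
  [seq (fun x => ab.1 x * cd.1 x, fun y => ab.2 y * cd.2 y) | ab <- s, cd <- t].

Fact tens_mulE s t z : tens (tens_mul s t) z = tens s z * tens t z.
Proof.
rewrite /tens big_allpairs_dep big_distrlr /=.
by apply: eq_bigr => ab _; apply: eq_bigr => cd _; rewrite mulrACA.
Qed.

Fact tens_mul_regular s t z : tens_regular_at s z -> tens_regular_at t z ->
  tens_regular_at (tens_mul s t) z.
Proof.
move=> sz tz _ /allpairsPdep[ab [cd [/sz[a b] /tz[c d] ->]]] /=.
by split; exact: regular_atM.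
Qed.

Fact tens_cat s t z : tens (s ++ t) z = tens s z + tens t z.
Proof. by rewrite /tens big_cat. Qed.

Fact tens_cat_regular s t z : tens_regular_at s z -> tens_regular_at t z ->
  tens_regular_at (s ++ t) z.
Proof. by move=> sz tz ab; rewrite mem_cat => /orP[/sz|/tz]. Qed.

Fact tens_cst c z : tens [:: (fun=> c, fun=> 1)] z = c.
Proof. by rewrite /tens big_seq1 mulr1. Qed.

Fact tens_cst_regular c z : tens_regular_at [:: (fun=> c, fun=> 1)] z.
Proof.
by move=> ab; rewrite inE => /eqP ->; split; exact: regular_at_cst.
Qed.

Fact fpair_openT : fpair_open setT.
Proof.
move=> z _; exists setT, setT, [:: (fun=> 1, fun=> 1)]; split => //.
- exact: openT.
- exact: openT.
- by move=> w _ _; exact: tens_cst_regular.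
- by split=> //; rewrite tens_cst oner_neq0.
Qed.

Fact fpair_openI : setI_closed fpair_open.
Proof.
move=> W W' oW oW' z [Wz W'z].
have [U [V [s [oU oV sr [Uz Vz sz] sW]]]] := oW _ Wz.
have [U' [V' [t [oU' oV' tr [U'z V'z tz] tW']]]] := oW' _ W'z.
exists (U `&` U'), (V `&` V'), (tens_mul s t); split.
- exact: openI.
- exact: openI.
- move=> w [? ?] [? ?]; apply: tens_mul_regular; [exact: sr|exact: tr].
- by split=> //; rewrite tens_mulE mulf_neq0.
move=> w [[Uw U'w] [Vw V'w]]; rewrite tens_mulE mulf_eq0 negb_or => /andP[sw tw].
by split; [exact: sW | exact: tW'].
Qed.

Fact fpair_open_bigU (I : Type) (f : I -> set fpair) :
  (forall i, fpair_open (f i)) -> fpair_open (\bigcup_i f i).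
Proof.
move=> of_ z [i _ /of_[U [V [s [oU oV sr sz sf]]]]].
by exists U, V, s; split=> // w /sf fw; exists i.
Qed.

HB.instance Definition _ := isOpenTopological.Build fpair
  fpair_openT fpair_openI fpair_open_bigU.

Lemma fpairE (W : set fpair) : open W <-> fpair_open W.
Proof. by []. Qed.

Fact tens_regular_box s z : tens_regular_at s z -> exists U V,
  [/\ open U, open V, U z.1, V z.2 &
      forall w, U w.1 -> V w.2 -> tens_regular_at s w].
Proof.
elim: s => [_|ab s IHs sz].
  by exists setT, setT; split=> //; exact: openT.
have [|ra rb] := sz ab; first by rewrite inE eqxx.
have [|U [V [oU oV Uz Vz sUV]]] := IHs.
  by move=> cd cds; apply: sz; rewrite inE cds orbT.
have : nbhs _ [set x | regular_at x ab.1] := regular_at_open ra.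
rewrite nbhsE => -[U' [oU' U'z] U'a].
have : nbhs _ [set y | regular_at y ab.2] := regular_at_open rb.
rewrite nbhsE => -[V' [oV' V'z] V'b].
exists (U `&` U'), (V `&` V'); split=> //; [exact: openI|exact: openI|].
move=> w [Uw U'w] [Vw V'w] cd; rewrite inE => /orP[/eqP ->|]; last exact: sUV.
by split; [exact: U'a | exact: V'b].
Qed.

Fact near_tens_neq0 s z : tens_regular_at s z -> tens s z != 0 ->
  \forall w \near z, tens s w != 0.
Proof.
move=> /tens_regular_box[U [V [oU oV Uz Vz sr]]] s0.
apply: (@filterS _ (nbhs z) _ (fpair_basic U V s)); first by move=> w [].
apply: open_nbhs_nbhs; split; last by split.
by move=> w [Uw Vw sw]; exists U, V, s; split.
Qed.

Fact near_tens s z : tens_regular_at s z ->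
  \forall w \near z, tens_regular_at s w.
Proof.
move=> /tens_regular_box[U [V [oU oV Uz Vz sr]]].
pose c : seq ((X -> k) * (Y -> k)) := [:: (fun=> 1, fun=> 1)].
have c0 w : tens c w != 0 by rewrite tens_cst oner_neq0.
apply: (@filterS _ (nbhs z) _ (fpair_basic U V c)); first by
  move=> w [Uw Vw _]; exact: sr.
apply: open_nbhs_nbhs; split; last by split.
by move=> w [Uw Vw sw]; exists U, V, c; split=> // *; exact: tens_cst_regular.
Qed.

Definition fpair_regular_at (z : fpair) (f : fpair -> k) : Prop :=
  exists s t, [/\ tens_regular_at s z, tens_regular_at t z, tens t z != 0 &
    \forall w \near z, f w = tens s w / tens t w].

Fact fpair_regular_at_near z f g : (\forall w \near z, f w = g w) ->
  fpair_regular_at z f -> fpair_regular_at z g.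
Proof.
move=> fg [s [t [sz tz t0 fE]]]; exists s, t; split => //.
by apply: filterS2 fg fE => y <-.
Qed.

Fact fpair_regular_at_open z f :
  fpair_regular_at z f -> \forall w \near z, fpair_regular_at w f.
Proof.
move=> [s [t [sz tz t0 fE]]].
have ts0 := near_tens_neq0 tz t0; have ffE := near_join fE.
have : \forall w \near z, tens_regular_at s w /\ tens_regular_at t w.
  by apply: filterS2 (near_tens sz) (near_tens tz).
by apply: filterS3 ts0 ffE => w tw fw [sw tw']; exists s, t; split.
Qed.

Fact fpair_regular_at_cst z (c : k) : fpair_regular_at z (fun=> c).
Proof.
exists [:: (fun=> c, fun=> 1)], [:: (fun=> 1, fun=> 1)].
split; rewrite ?tens_cst ?oner_neq0 //; try exact: tens_cst_regular.
by apply: filterE => y; rewrite !tens_cst divr1.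
Qed.

Fact fpair_regular_atD z f g : fpair_regular_at z f -> fpair_regular_at z g ->
  fpair_regular_at z (fun w => f w + g w).
Proof.
move=> [p [q [pr qr q0 fE]]] [r [s [rr sr s0 gE]]].
exists (tens_mul p s ++ tens_mul r q), (tens_mul q s); split.
- by apply: tens_cat_regular; exact: tens_mul_regular.
- exact: tens_mul_regular.
- by rewrite tens_mulE mulf_neq0.
have qs0 : tens (tens_mul q s) z != 0 by rewrite tens_mulE mulf_neq0.
have qsE := near_tens_neq0 (tens_mul_regular qr sr) qs0.
apply: filterS3 fE gE qsE => y -> ->.
rewrite tens_mulE mulf_eq0 negb_or => /andP[qy sy].
by rewrite addf_div // tens_cat !tens_mulE.
Qed.

Fact fpair_regular_atM z f g : fpair_regular_at z f -> fpair_regular_at z g ->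
  fpair_regular_at z (fun w => f w * g w).
Proof.
move=> [p [q [pr qr q0 fE]]] [r [s [rr sr s0 gE]]].
exists (tens_mul p r), (tens_mul q s); split; try exact: tens_mul_regular.
  by rewrite tens_mulE mulf_neq0.
by apply: filterS2 fE gE => y -> ->; rewrite mulf_div !tens_mulE.
Qed.

(* The product in the category of spaces with functions; on varieties it is the
   fibre product over k. *)
Definition prod_fspace : fspace k :=
  @FSpace k fpair fpair_regular_at fpair_regular_at_near fpair_regular_at_open
    fpair_regular_at_cst fpair_regular_atD fpair_regular_atM.

End Product.

Section Varieties.
Context (k : closedFieldType).

Definition is_affine (X : fspace k) : Prop :=
  exists n (Z : set (affine_space k n)),
    closed Z /\ fiso X (subfspace Z).

(* Not assumed irreducible, nor nonempty. *)
Definition is_variety (X : fspace k) : Prop :=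
  (exists n (U : 'I_n -> set X),
    [/\ forall i, open (U i), \bigcup_i U i = setT &
        forall i, is_affine (subfspace (U i))]) /\
  closed [set z : prod_fspace X X | z.1 = z.2].

Record variety := Variety {
  vspace :> fspace k;
  varietyP : is_variety vspace
}.

Record alg_group := AlgGroup {
  gvar :> variety;
  gmul : gvar -> gvar -> gvar;
  gone : gvar;
  ginv : gvar -> gvar;
  gmulA : associative gmul;
  gmul1 : left_id gone gmul;
  gmulV : left_inverse gone ginv gmul;
  gmul_morphism :
    fmorphism (X := prod_fspace gvar gvar) (fun z => gmul z.1 z.2);
  ginv_morphism : fmorphism ginv
}.

End Varieties.

Section Actions.
Context (k : closedFieldType) (G : alg_group k).

Definition is_action (X : fspace k) (act : G -> X -> X) : Prop :=
  [/\ fmorphism (X := prod_fspace G X) (fun z => act z.1 z.2),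
      forall x, act (gone G) x = x &
      forall g h x, act (gmul g h) x = act g (act h x)].

Section Action.
Context (X : fspace k) (act : G -> X -> X).

Definition ginvariant (W : set X) : Prop := forall g x, W x -> W (act g x).

Definition gorbit (x : X) : set X := range (act^~ x).

Definition orbitwise_closed (A : set X) : Prop :=
  forall a, A a -> closure (gorbit a) `<=` A.

Lemma orbitwise_closed_ginvariant A : orbitwise_closed A -> ginvariant A.
Proof. by move=> cA g x /cA; apply; apply: subset_closure; exists g. Qed.

Lemma complement_ginvariant (Y U : set X) : is_action act ->
  Y `|` U = setT -> Y `&` U = set0 -> ginvariant U -> ginvariant Y.
Proof.
move=> [_ act1 actM] YUT YU0 iU g x Yx.
have : (Y `|` U) (act g x) by rewrite YUT.
case=> // /(iU (ginv g)); rewrite -actM gmulV act1 => Ux.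
by have : (Y `&` U) x by []; rewrite YU0.
Qed.

Definition restr_act (A : set X) (iA : ginvariant A) :
    G -> subfspace A -> subfspace A :=
  fun g a => SigSub (mem_set (iA g (val a) (set_valP a))).

Definition pseudo_quotient (Q : fspace k) (p : X -> Q) : Prop :=
  [/\ is_variety Q, fmorphism p, range p = setT,
      forall g x, p (act g x) = p x &
      forall W1 W2 : set X, closed W1 -> closed W2 ->
        ginvariant W1 -> ginvariant W2 -> W1 `&` W2 = set0 ->
        closure (p @` W1) `&` closure (p @` W2) = set0].

End Action.
End Actions.

Definition restr_image (k : closedFieldType) (X Q : fspace k) (p : X -> Q)
    (A : set X) : subfspace A -> subfspace (p @` A) :=
  fun a => SigSub (mem_set (imageP p (set_valP a))).

Section GrothendieckRing.
Context (k : closedFieldType).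

(* KVar is presented as a commutative ring by the generators [X] and the
   relations kcong_iso, kcong_scissor, kcong_prod and kcong_point, the last one making
   the class of the point the unit for the cartesian product. *)
Inductive kexpr :=
| KGen of variety k
| KZero | KOne
| KOpp of kexpr
| KAdd of kexpr & kexpr
| KMul of kexpr & kexpr.

Inductive kcong : kexpr -> kexpr -> Prop :=
| kcong_refl a : kcong a a
| kcong_sym a b : kcong a b -> kcong b a
| kcong_trans b a c : kcong a b -> kcong b c -> kcong a c
| kcong_opp a b : kcong a b -> kcong (KOpp a) (KOpp b)
| kcong_add a b c d : kcong a b -> kcong c d -> kcong (KAdd a c) (KAdd b d)
| kcong_mul a b c d : kcong a b -> kcong c d -> kcong (KMul a c) (KMul b d)
| kcong_addA a b c : kcong (KAdd a (KAdd b c)) (KAdd (KAdd a b) c)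
| kcong_addC a b : kcong (KAdd a b) (KAdd b a)
| kcong_add0 a : kcong (KAdd KZero a) a
| kcong_addN a : kcong (KAdd (KOpp a) a) KZero
| kcong_mulA a b c : kcong (KMul a (KMul b c)) (KMul (KMul a b) c)
| kcong_mulC a b : kcong (KMul a b) (KMul b a)
| kcong_mul1 a : kcong (KMul KOne a) a
| kcong_mulD a b c : kcong (KMul (KAdd a b) c) (KAdd (KMul a c) (KMul b c))
| kcong_iso (X Y : variety k) : fiso X Y -> kcong (KGen X) (KGen Y)
| kcong_scissor (X Y U : variety k) (A : set X) : closed A ->
    fiso Y (subfspace A) -> fiso U (subfspace (~` A)) ->
    kcong (KGen X) (KAdd (KGen Y) (KGen U))
| kcong_prod (X Y P : variety k) : fiso P (prod_fspace X Y) ->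
    kcong (KGen P) (KMul (KGen X) (KGen Y))
| kcong_point (P : variety k) : fiso P (affine_space k 0) ->
    kcong (KGen P) KOne.

Lemma kcong_eqE a b : kcong a = kcong b <-> kcong a b.
Proof.
split=> [ab|ab]; first by rewrite ab; exact: kcong_refl.
apply/funext => c; apply/propext; split; last exact: kcong_trans.
by apply: kcong_trans; exact: kcong_sym.
Qed.

(* The quotient of kexpr by kcong, as the type of equivalence classes.  It is
   not declared as a comPzRingType (hence as an eqType), because kexpr ranges
   over all topologicalTypes and so lives in too large a universe; that it is a
   commutative ring is proved below. *)
Definition KVar := {E : kexpr -> Prop | exists a, E = kcong a}.

Definition kclass (a : kexpr) : KVar := exist _ (kcong a) (ex_intro _ a erefl).

Definition krepr (x : KVar) : kexpr := projT1 (cid (proj2_sig x)).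

Lemma kclassP a b : kclass a = kclass b <-> kcong a b.
Proof.
split=> [[/kcong_eqE]//|/kcong_eqE ab]; exact: eq_exist.
Qed.

Lemma kreprK x : kclass (krepr x) = x.
Proof.
by case: x => E EP; apply: eq_exist; rewrite /krepr /=; case: cid.
Qed.

Definition KVar0 : KVar := kclass KZero.
Definition KVar1 : KVar := kclass KOne.
Definition KVar_opp (x : KVar) : KVar := kclass (KOpp (krepr x)).
Definition KVar_add (x y : KVar) : KVar := kclass (KAdd (krepr x) (krepr y)).
Definition KVar_mul (x y : KVar) : KVar := kclass (KMul (krepr x) (krepr y)).

Definition kvar (X : variety k) : KVar := kclass (KGen X).

Fact kcong_repr a : kcong (krepr (kclass a)) a.
Proof. by apply/kclassP; rewrite kreprK. Qed.

Lemma kclassN a : kclass (KOpp a) = KVar_opp (kclass a).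
Proof. exact/kclassP/kcong_sym/kcong_opp/kcong_repr. Qed.

Lemma kclassD a b : kclass (KAdd a b) = KVar_add (kclass a) (kclass b).
Proof. by apply/kclassP/kcong_sym/kcong_add; exact: kcong_repr. Qed.

Lemma kclassM a b : kclass (KMul a b) = KVar_mul (kclass a) (kclass b).
Proof. by apply/kclassP/kcong_sym/kcong_mul; exact: kcong_repr. Qed.

Fact kclassW (P : KVar -> Prop) : (forall a, P (kclass a)) -> forall x, P x.
Proof. by move=> Pa x; rewrite -[x]kreprK. Qed.

Lemma KVar_addA : associative KVar_add.
Proof.
apply: kclassW => a; apply: kclassW => b; apply: kclassW => c.
by rewrite -!kclassD; exact/kclassP/kcong_addA.
Qed.

Lemma KVar_addC : commutative KVar_add.
Proof.
apply: kclassW => a; apply: kclassW => b.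
by rewrite -!kclassD; exact/kclassP/kcong_addC.
Qed.

Lemma KVar_add0 : left_id KVar0 KVar_add.
Proof. by apply: kclassW => a; rewrite -kclassD; exact/kclassP/kcong_add0. Qed.

Lemma KVar_addN : left_inverse KVar0 KVar_opp KVar_add.
Proof.
by apply: kclassW => a; rewrite -kclassN -kclassD; exact/kclassP/kcong_addN.
Qed.

Lemma KVar_mulA : associative KVar_mul.
Proof.
apply: kclassW => a; apply: kclassW => b; apply: kclassW => c.
by rewrite -!kclassM; exact/kclassP/kcong_mulA.
Qed.

Lemma KVar_mulC : commutative KVar_mul.
Proof.
apply: kclassW => a; apply: kclassW => b.
by rewrite -!kclassM; exact/kclassP/kcong_mulC.
Qed.

Lemma KVar_mul1 : left_id KVar1 KVar_mul.
Proof. by apply: kclassW => a; rewrite -kclassM; exact/kclassP/kcong_mul1. Qed.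

Lemma KVar_mulD : left_distributive KVar_mul KVar_add.
Proof.
apply: kclassW => a; apply: kclassW => b; apply: kclassW => c.
by rewrite -kclassD -!kclassM -kclassD; exact/kclassP/kcong_mulD.
Qed.

End GrothendieckRing.

(* Main.v *)
Require Import Defs.
From mathcomp Require Import all_boot all_order all_algebra closed_field.
From mathcomp Require Import all_classical.
From mathcomp Require Import topology.
From mathcomp Require Import -(notations) mpoly.

(* The closure of an orbit in U is a closed invariant set disjoint from Y, so
   p(U) misses the closure of p(Y); hence p(Y) is closed with complement p(U),
   and Y and U are saturated.  For two invariant relatively closed subsets of a
   saturated set whose images both accumulate at q, the fibre over q is a closed
   invariant set that must meet both of them, and this gives the separation
   property of the restricted maps.

   A pseudo-quotient p is a quotient map of topological spaces, and its fibres
   depend only on the action.  Two pseudo-quotients Q1, Q2 of X are therefore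
   related by a homeomorphism phi.  In characteristic zero, phi is an isomorphism
   over a nonempty open subset of every irreducible closed subset of Q1, and
   Noetherian induction then yields [Q1] = [Q2].  For the generic isomorphism one
   needs that a function h on an irreducible Z, which becomes regular after
   pullback to X, is regular on a nonempty open subset.  Its graph is
   constructible, so it contains a dense open part of its closure.  If
   P(z, t) of minimal degree d in t vanishes on the graph, then for general z
   every root of P(z, -) is a value of h, so P(z, t) = c(z) (t - h(z))^d, and
   since d is invertible the coefficient of t^(d-1) shows that h is rational. *)

Set Implicit Arguments.
Unset Strict Implicit.
Unset Printing Implicit Defensive.

Import GRing.Theory.
Local Open Scope classical_set_scope.
Local Open Scope ring_scope.

(** * Functions with a constructible graph *)

Section GenericValue.
Context (k : closedFieldType) (A : idomainType) (S : Type).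
Context (ev : S -> {rmorphism A -> k}) (h : S -> k).

Definition pval (s : S) (P : {poly A}) (t : k) : k := (map_poly (ev s) P).[t].

Definition pvanish (P : {poly A}) : Prop := forall s, pval s P (h s) = 0.

(** The maps [ev s] need not be jointly injective, so [a != 0] would still allow a coefficient that
    vanishes at every point. *)
Definition evnz (a : A) : Prop := exists s, ev s a != 0.

(** The ideal of the graph of [h] is prime: irreducibility of the base is used in this form. *)
Hypothesis pvanish_prime : forall P R, pvanish (P * R) -> pvanish P \/ pvanish R.

Lemma pvalM s P R t : pval s (P * R) t = pval s P t * pval s R t.
Proof. by rewrite /pval rmorphM hornerM. Qed.

Lemma pvalD s P R t : pval s (P + R) t = pval s P t + pval s R t.
Proof. by rewrite /pval rmorphD hornerD. Qed.

Lemma pvalZ s a P t : pval s (a *: P) t = ev s a * pval s P t.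
Proof. by rewrite /pval map_polyZ hornerZ. Qed.

Lemma pvalC s a t : pval s a%:P t = ev s a.
Proof. by rewrite /pval map_polyC hornerC. Qed.

Lemma evnzM a b : evnz a -> evnz b -> evnz (a * b).
Proof.
move=> [s sa] [s' sb]; apply: contrapT => ab.
have [x|z|z] := @pvanish_prime a%:P b%:P.
- rewrite pvalM !pvalC -rmorphM /=; apply/eqP/negPn/negP => abx; apply: ab.
  by exists x.
- by move: (z s); rewrite pvalC => sa0; rewrite sa0 eqxx in sa.
- by move: (z s'); rewrite pvalC => sb0; rewrite sb0 eqxx in sb.
Qed.

Lemma evnzX a n : evnz a -> evnz (a ^+ n).
Proof. by move=> [s sa]; exists s; rewrite rmorphXn expf_neq0. Qed.

(** Below size [m] the leading coefficient of a polynomial of the ideal is zero at every point, so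
    removing the leading term changes no specialization; induction on the size finishes. *)
Lemma pvanish_low m :
    (forall P, pvanish P -> evnz (lead_coef P) -> (m <= size P)%N) ->
  forall P, pvanish P -> (size P < m)%N -> forall s, map_poly (ev s) P = 0.
Proof.
move=> low P; have [n] := ubnP (size P); elim: n P => // n IHn P Pn vP Pm s.
have [->|P0] := eqVneq P 0; first by rewrite map_poly0.
have lP s' : ev s' (lead_coef P) = 0.
  apply/eqP/negPn/negP => sP; move: Pm; rewrite ltnNge => /negP; apply.
  by apply: low => //; exists s'.
pose R := P - lead_coef P *: 'X^((size P).-1).
have RP s' : map_poly (ev s') R = map_poly (ev s') P.
  by rewrite rmorphB /= map_polyZ /= lP scale0r subr0.
have Rs : (size R < size P)%N.
  have sP : (0 < size P)%N by rewrite size_poly_gt0.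
  rewrite -[X in (_ < X)%N](prednK sP) ltnS; apply/leq_sizeP => j jP.
  rewrite coefB coefZ coefXn; have [->|jN] := eqVneq j (size P).-1.
    by rewrite mulr1 subrr.
  rewrite mulr0 subr0 nth_default // -(prednK sP) ltn_neqAle.
  by rewrite eq_sym jN.
rewrite -RP; apply: IHn.
- exact: leq_trans Rs _.
- by move=> s'; rewrite /pval RP; exact: vP.
- exact: ltn_trans Rs Pm.
Qed.


(** Otherwise every polynomial of the ideal specializes to zero, and [gS] would force every nonroot
    of [g] at [s0] to equal [h s0]; but [k] is infinite. *)
Lemma exists_pvanish (g : {poly A}) (s0 : S) :
    pval s0 g (h s0) != 0 ->
    (forall s t, (forall P, pvanish P -> pval s P t = 0) -> pval s g t != 0 ->
      t = h s) ->
  exists P, pvanish P /\ evnz (lead_coef P).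
Proof.
move=> g0 gS; apply: contrapT => noP.
have all0 P : pvanish P -> forall s, map_poly (ev s) P = 0.
  move=> vP; apply: (@pvanish_low (size P).+1) => // R vR lR.
  by case: noP; exists R.
have : map_poly (ev s0) g * ('X - (h s0)%:P) != 0.
  rewrite mulf_neq0 ?polyXsubC_eq0 //; apply: contra_neq g0 => g0.
  by rewrite /pval g0 horner0.
move=> /closed_nonrootP[t]; rewrite rootM negb_or root_XsubC => /andP[gt].
apply/negP; rewrite negbK; apply/eqP/gS => //.
by move=> P /all0 P0; rewrite /pval P0 horner0.
Qed.

(* [P] has minimal degree in [t] among the polynomials that vanish on the graph
   of [h].  A polynomial [g] of minimal degree among those for which the roots
   [t] of [P] with [g t != 0] are values of [h] is constant, as seen by dividing
   [g] by [P] and [P] by [g]. *)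
Lemma exists_generic_root (g : {poly A}) (s0 : S) :
    pval s0 g (h s0) != 0 ->
    (forall s t, (forall P, pvanish P -> pval s P t = 0) -> pval s g t != 0 ->
      t = h s) ->
  exists P c, [/\ pvanish P, evnz (lead_coef P), evnz c &
    forall s t, ev s c != 0 -> ev s (lead_coef P) != 0 -> pval s P t = 0 ->
      t = h s].
Proof.
move=> g0 gS; have [P0 [vP0 lP0]] := exists_pvanish g0 gS.
have exP : exists n, `[< exists P, [/\ pvanish P, evnz (lead_coef P) & size P = n] >].
  by exists (size P0); apply/asboolP; exists P0.
have [m /asboolP[P [vP lP Pm]] minP] := ex_minnP exP.
have low : forall R, pvanish R -> (size R < size P)%N ->
    forall s, map_poly (ev s) R = 0.
  apply: pvanish_low => R vR lR; rewrite Pm.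
  by apply: minP; apply/asboolP; exists R.
have Pn0 : P != 0.
  by rewrite -lead_coef_eq0; case: lP => s; apply: contra_neq => ->; rewrite rmorph0.
pose valid (f : {poly A}) := [/\ ~ pvanish f &
  forall s t, ev s (lead_coef P) != 0 -> pval s P t = 0 -> pval s f t != 0 ->
    t = h s].
(* Pseudo-division by [P]: the remainder of a vanishing [R] vanishes on the graph and is shorter
   than [P], so it specializes to zero, and roots of [P] are roots of [R] where [lead_coef P] is
   nonzero. *)
have valid_g : valid g.
  split=> [vg|s t ls Pt gt]; first by rewrite vg eqxx in g0.
  apply: gS => // R vR; set c := lead_coef P in ls.
  have /(congr1 (fun Q => pval s Q t)) := Pdiv.WeakIdomain.divp_eq R P.
  rewrite pvalZ pvalD pvalM Pt mulr0 add0r rmorphXn.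
  rewrite [X in _ = X](_ : _ = 0) => [/eqP|].
    by rewrite mulf_eq0 expf_eq0 (negbTE ls) andbF /= => /eqP.
  rewrite /pval low ?horner0 // ?ltn_modp //.
  move=> s'; have /(congr1 (fun Q => pval s' Q (h s'))) := Pdiv.WeakIdomain.divp_eq R P.
  by rewrite pvalZ pvalD pvalM vP vR !mulr0 add0r.
have exg : exists n, `[< exists f, valid f /\ size f = n >].
  by exists (size g); apply/asboolP; exists g.
have [m' /asboolP[f [[vf fS] fm]] minf] := ex_minnP exg.
have {minf fm m' exg valid_g gS g0} minf R : valid R -> (size f <= size R)%N.
  by move=> vR; rewrite fm; apply: minf; apply/asboolP; exists R.
have f0 : f != 0.
  by apply/eqP => f0; apply: vf => s; rewrite f0 /pval map_poly0 horner0.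
have vP_const a R : evnz a -> pvanish (a *: R) -> pvanish R.
  move=> [s sa]; rewrite -mul_polyC => /pvanish_prime[] // /(_ s).
  by rewrite pvalC => sa0; rewrite sa0 eqxx in sa.
(* Otherwise the remainder of [f] by [P], which at a root of [P] is a multiple of [f], would be a
   shorter valid polynomial. *)
have fP : (size f < size P)%N.
  rewrite ltnNge; apply/negP => Pf.
  have := Pdiv.WeakIdomain.divp_eq f P; set c := lead_coef P ^+ _ => fE.
  have : (size f <= size (f %% P)%R)%N.
    apply: minf; split.
      move=> vR; apply: vf; apply: (@vP_const c); first exact: evnzX.
      by move=> s; rewrite fE pvalD pvalM vP vR mulr0 addr0.
    move=> s t ls Pt Rt; apply: fS => //; apply: contra_neq Rt => ft.
    by have := congr1 (fun Q => pval s Q t) fE; rewrite pvalZ pvalD pvalM ft Pt !mulr0 add0r.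
  by rewrite leqNgt (leq_trans _ Pf) // ltn_modp.
(* A leading coefficient vanishing at every point could be stripped, leaving a shorter valid
   polynomial. *)
have lf : evnz (lead_coef f).
  apply: contrapT => lf.
  have lf0 s : ev s (lead_coef f) = 0.
    by apply/eqP/negPn/negP => sl; apply: lf; exists s.
  pose R := f - lead_coef f *: 'X^((size f).-1).
  have Rf s t : pval s R t = pval s f t.
    rewrite /pval rmorphB /= map_polyZ /= lf0 scale0r subr0 //.
  have : (size f <= size R)%N.
    apply: minf; split=> [vR|s t ls Pt]; last by rewrite Rf; exact: fS.
    by apply: vf => s; rewrite -Rf.
  have sf : (0 < size f)%N by rewrite size_poly_gt0.
  rewrite leqNgt -[X in (_ < X)%N](prednK sf) ltnS => /negP; apply.
  apply/leq_sizeP => j jf; rewrite coefB coefZ coefXn.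
  have [->|jN] := eqVneq j (size f).-1; first by rewrite mulr1 subrr.
  rewrite mulr0 subr0 nth_default // -(prednK sf) ltn_neqAle eq_sym jN.
  by [].
have [f1|f1] := leqP (size f) 1.
  exists P, f`_0; split => //.
    by move: lf; rewrite /lead_coef; case: (size f) f1 => [|[]].
  move=> s t fs ls Pt; apply: fS => //.
  by rewrite (size1_polyC f1) pvalC.
(* If [f] had positive degree, the remainder of [P] by [f] would vanish on the graph by minimality
   of [f], and then the quotient by primality. Both are shorter than [P], so they specialize to
   zero, and with them a nonzero multiple of [lead_coef P]. *)
have := Pdiv.WeakIdomain.divp_eq P f; set c := lead_coef f ^+ _ => PE.
have vR : pvanish (P %% f).
  apply: contrapT => nvR; have : (size f <= size (P %% f)%R)%N.
    apply: minf; split=> // s t ls Pt Rt; apply: fS => //.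
    apply: contra_neq Rt => ft.
    have := congr1 (fun Q => pval s Q t) PE.
    by rewrite pvalZ pvalD pvalM ft Pt !mulr0 add0r.
  by rewrite leqNgt ltn_modp f0.
have vS : pvanish (P %/ f).
  have [s|//|/vf//] := @pvanish_prime (P %/ f) f.
  have := congr1 (fun Q => pval s Q (h s)) PE.
  by rewrite pvalZ pvalD vP vR mulr0 addr0.
have SP : (size (P %/ f)%R < size P)%N.
  rewrite size_divp // ltn_subrL -subn1 subn_gt0 f1.
  exact: leq_trans (ltnW f1) (ltnW fP).
have RP : (size (P %% f)%R < size P)%N by apply: ltn_trans fP; rewrite ltn_modp.
have [s] : evnz (c * lead_coef P) by apply: evnzM => //; exact: evnzX.
have /(congr1 (fun Q => (map_poly (ev s) Q)`_(size P).-1)) := PE.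
rewrite rmorphD rmorphM /= (low _ vS SP) (low _ vR RP) mul0r addr0 coef0.
by rewrite map_polyZ coefZ coef_map -/(lead_coef P) rmorphM => ->; rewrite eqxx.
Qed.

(* Characteristic zero: [h s] is the only root of [P] at [s], so it is the mean
   of the [d] roots, which the coefficient of degree [d - 1] computes. *)
Lemma generic_value_rational (g : {poly A}) (s0 : S) : [pchar k] =i pred0 ->
    pval s0 g (h s0) != 0 ->
    (forall s t, (forall P, pvanish P -> pval s P t = 0) -> pval s g t != 0 ->
      t = h s) ->
  exists b c, evnz c /\ forall s, ev s c != 0 -> h s = ev s b / ev s c.
Proof.
move=> k0 g0 gS; have [P [c [vP lP cnz Pc]]] := exists_generic_root g0 gS.
set d := (size P).-1.
have d0 : (0 < d)%N.
  rewrite /d -subn1 subn_gt0 ltnNge; apply/negP => P1.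
  move: lP vP; rewrite (size1_polyC P1) lead_coefC => -[s /eqP sP] /(_ s).
  by rewrite pvalC.
(* Vieta: the coefficient of degree [d - 1] at [s] is [- d * lead_coef P * h s]. The common factor
   [c] confines the formula to points where [h s] is the only root of [P]. *)
exists (- P`_d.-1 * c), ((lead_coef P *+ d) * c); split.
  apply: evnzM => //; case: lP => s sP; exists s; rewrite rmorphMn /= -mulr_natr.
  by rewrite mulf_neq0 // ((pcharf0P _).1 k0) -lt0n.
move=> s; rewrite rmorphM mulf_eq0 negb_or rmorphMn /= => /andP[lc sc].
have ls : ev s (lead_coef P) != 0 by apply: contra_neq lc => ->; rewrite mul0rn.
have [r Pr] := closed_field_poly_normal (map_poly (ev s) P).
have lPs : lead_coef (map_poly (ev s) P) = ev s (lead_coef P).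
  by rewrite lead_coef_map_eq.
rewrite lPs in Pr.
have szr : size r = d.
  rewrite /d -(size_map_poly_id0 ls) Pr size_scale // size_prod_XsubC.
  by [].
have rh z : z \in r -> z = h s.
  move=> zr; apply: Pc => //; rewrite /pval Pr hornerZ.
  have /rootP -> : root (\prod_(z <- r) ('X - z%:P)) z by rewrite root_prod_XsubC.
  by rewrite mulr0.
have sumr : \sum_(z <- r) z = h s *+ d.
  rewrite big_seq (eq_bigr (fun=> h s)) // -big_seq big_const_seq count_predT szr.
  by rewrite iter_addr_0.
have /(congr1 (fun Q : {poly k} => Q`_d.-1)) := Pr.
rewrite coef_map coefZ -szr coefPn_prod_XsubC ?szr -?lt0n // sumr => PE.
rewrite !rmorphM rmorphN /= PE mulrN opprK invfM mulrACA divff // mulr1.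
by apply: (mulIf lc); rewrite divfK // !mulrnAr mulrC.
Qed.

End GenericValue.
(** * Hilbert's basis theorem *)

Lemma mpoly_alg_ind (n : nat) (R : comNzRingType) (P : mpoly n R -> Prop) :
    (forall c, P (mpolyC n c)) -> (forall i, P (mpolyX R (mnm1 i))) ->
    (forall p q, P p -> P q -> P (p + q)) ->
    (forall p q, P p -> P q -> P (p * q)) ->
  forall p, P p.
Proof.
move=> PC PX PD PM; elim/mpolyind => [|c m p _ _ Pp].
  by rewrite -mpolyC0; exact: PC.
apply: (PD) => //; rewrite -mul_mpolyC; apply: (PM) => //.
rewrite mpolyXE_id; apply: (big_ind P); first by rewrite -mpolyC1; exact: PC.
  exact: PM.
move=> i _; move: (fun_of_multinom m i); elim=> [|e IHe]; first by rewrite expr0 -mpolyC1; exact: PC.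
by rewrite exprS; exact: PM.
Qed.

Section IdealSpan.
Context (R : comNzRingType).

Inductive ispan (S : set R) : R -> Prop :=
| ispan0 : ispan S 0
| ispan_cons a x y : S x -> ispan S y -> ispan S (a * x + y).

Lemma ispanD S x y : ispan S x -> ispan S y -> ispan S (x + y).
Proof.
elim=> [|a z w Tz _ IHw] Ty; first by rewrite add0r.
by rewrite -addrA; apply: ispan_cons => //; exact: IHw.
Qed.

Lemma ispanM S a x : ispan S x -> ispan S (a * x).
Proof.
elim=> [|b z w Tz _ IHw]; first by rewrite mulr0; exact: ispan0.
by rewrite mulrDr mulrA; exact: ispan_cons.
Qed.

Lemma ispan_sub S T : S `<=` ispan T -> ispan S `<=` ispan T.
Proof.
move=> ST x; elim=> [|a y z /ST Ty _ IHz]; first exact: ispan0.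
by apply: ispanD => //; exact: ispanM.
Qed.

Lemma sub_ispan (S : set R) : S `<=` ispan S.
Proof.
by move=> x Sx; rewrite -[x]mul1r -[_ * _]addr0; apply: ispan_cons => //; exact: ispan0.
Qed.

Lemma ispan_mono (S T : set R) : S `<=` T -> ispan S `<=` ispan T.
Proof. by move=> ST; apply: ispan_sub => x /ST /sub_ispan. Qed.

Lemma ispan_finite S x : ispan S x ->
  exists s : seq R, [set` s] `<=` S /\ ispan [set` s] x.
Proof.
elim=> [|a y z Sy _ [s [sS sz]]]; first by exists [::]; split=> //; exact: ispan0.
exists (y :: s); split=> [w|]; first by rewrite /= inE => /orP[/eqP->|/sS].
apply: ispan_cons; first by rewrite /= inE eqxx.
by apply: ispan_mono sz => w; rewrite /= inE orbC => ->.
Qed.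

(** Formulated for arbitrary subsets instead of ideals, so that finitely many generators can be
    extracted from a given family. *)
Definition noetherian : Prop :=
  forall S : set R, exists s : seq R, [set` s] `<=` S /\ S `<=` ispan [set` s].

End IdealSpan.

Lemma noetherian_field (k : fieldType) : noetherian k.
Proof.
move=> S; have [[x [Sx x0]]|S0] := pselect (exists x, S x /\ x != 0).
  exists [:: x]; split=> [y|y _]; first by rewrite /= inE => /eqP->.
  rewrite -[y](divfK x0); apply: ispanM; apply: sub_ispan.
  by rewrite /= inE.
exists [::]; split=> // x Sx; suff -> : x = 0 by exact: ispan0.
by apply/eqP/negPn/negP => x0; apply: S0; exists x.
Qed.

Lemma noetherian_surj (R T : comNzRingType) (f : R -> T) : f 0 = 0 ->
    {morph f : x y / x + y} -> {morph f : x y / x * y} ->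
    (forall y, exists x, f x = y) ->
  noetherian R -> noetherian T.
Proof.
move=> f0 fD fM fS nR S; have [s [sS Ss]] := nR (f @^-1` S).
exists (map f s); split=> [_ /mapP[x /sS Sx ->]//|y].
have [x <-] := fS y => /Ss; elim=> [|a z w sz _ IHw].
  by rewrite f0; exact: ispan0.
by rewrite fD fM; apply: ispan_cons => //; exact: map_f.
Qed.

(* Otherwise choose [x n] in the ideal, of least degree outside the span of
   [x 0, ..., x n.-1]; the leading coefficients of the [x n] then generate an
   ideal that is not finitely generated. *)
Lemma noetherian_poly (R : comNzRingType) : noetherian R -> noetherian {poly R}.
Proof.
move=> nR S; apply: contrapT => nS.
have next (s : seq {poly R}) : exists x, [set` s] `<=` ispan S ->
    [/\ ispan S x, ~ ispan [set` s] x &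
    forall y, ispan S y -> ~ ispan [set` s] y -> (size x <= size y)%N].
  have [sS|] := pselect ([set` s] `<=` ispan S); last by exists 0.
  have [x [Sx sx]] : exists x, ispan S x /\ ~ ispan [set` s] x.
    apply: contrapT => sI; apply: nS.
    (* Were [s] to span the ideal, expressing each member of [s] by finitely many members of [S]
       would give finite generators inside [S]. *)
    have [t [tS st]] : exists t : seq {poly R},
        [set` t] `<=` S /\ [set` s] `<=` ispan [set` t].
      elim: s sS {sI} => [|x s IHs] sS; first by exists [::].
      have [|t [tS st]] := IHs.
        by move=> y ys; apply: sS; rewrite /= inE; apply/orP; right.
      have [|u [uS xu]] := @ispan_finite _ S x.
        by apply: sS; rewrite /= inE eqxx.
      exists (u ++ t); split=> y; rewrite /= ?mem_cat ?inE => /orP[].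
      - exact: uS.
      - exact: tS.
      - by move=> /eqP->; apply: ispan_mono xu => z; rewrite /= mem_cat => ->.
      - move=> /st; apply: ispan_mono => z; rewrite /= mem_cat => ->.
        by rewrite orbT.
    exists t; split=> // y Sy; apply: (ispan_sub st).
    by apply: contrapT => sy; apply: sI; exists y; split=> //; exact: sub_ispan.
  have exm : exists n,
      `[< exists y, [/\ ispan S y, ~ ispan [set` s] y & size y = n] >].
    by exists (size x); apply/asboolP; exists x.
  have [m /asboolP[y [Sy sy ym]] minm] := ex_minnP exm.
  exists y => _; split=> // z Sz sz; rewrite ym; apply: minm; apply/asboolP.
  by exists z.
have [nxt nxtP] := choice next.
pose ss := fix ss n := if n is m.+1 then nxt (ss m) :: ss m else [::].
pose x n := nxt (ss n).
have ssS n : [set` ss n] `<=` ispan S.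
  elim: n => [|n IHn] // y; rewrite /= inE => /orP[/eqP->|/IHn//].
  by have [] := nxtP _ IHn.
have memss i n : (i < n)%N -> x i \in ss n.
  elim: n => // n IHn; rewrite ltnS leq_eqVlt inE => /orP[/eqP->|/IHn ->].
    by rewrite eqxx.
  by rewrite orbT.
have ss_sub i n : (i <= n)%N -> [set` ss i] `<=` [set` ss n].
  elim: n => [|n IHn]; first by rewrite leqn0 => /eqP->.
  rewrite leq_eqVlt => /orP[/eqP->//|/IHn iS y /iS /=].
  by rewrite inE orbC => ->.
have szx i n : (i <= n)%N -> (size (x i) <= size (x n))%N.
  move=> le_in; have [_ _] := nxtP _ (@ssS i); apply.
    by have [] := nxtP _ (@ssS n).
  have [_ nx _] := nxtP _ (@ssS n); apply: contra_not nx.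
  by apply: ispan_mono; exact: ss_sub.
have [s [sL Ls]] := nR (range (fun n => lead_coef (x n))).
(* The finitely many generating leading coefficients all belong to some [x i] with [i < N]. *)
have [N sN] : exists N, forall y, y \in s ->
    exists2 i, (i < N)%N & y = lead_coef (x i).
  elim: s sL {Ls} => [|y s IHs] sL; first by exists 0%N.
  have [|N sN] := IHs.
    by move=> z zs; apply: sL; rewrite /= inE; apply/orP; right.
  have [|i _ xi] := sL y; first by rewrite /= inE eqxx.
  exists (maxn i.+1 N) => z; rewrite inE => /orP[/eqP->|/sN[j jN ->]].
    by exists i => //; exact: leq_maxl.
  by exists j => //; apply: leq_trans jN _; exact: leq_maxr.
have [xS xN xmin] := nxtP _ (@ssS N).
rewrite -/(x N) in xS xN xmin.
(* A combination of shifts ['X^e * x i] with [i < N] has the top coefficient of [x N]. Subtracting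
   it from [x N] leaves a shorter element still outside the span, against the choice of [x N]. *)
have [z [zs zN zsz]] : exists z : {poly R}, [/\ ispan [set` ss N] z,
    z`_(size (x N)).-1 = lead_coef (x N) & (size z <= size (x N))%N].
  have : ispan [set` s] (lead_coef (x N)) by apply: Ls; exists N.
  elim=> [|a _ w /sN[i iN ->] _ [z [zs zN zsz]]].
    by exists 0; rewrite coef0 size_poly0; split=> //; exact: ispan0.
  have lei := szx _ _ (ltnW iN).
  pose y := a *: ('X^(size (x N) - size (x i)) * x i).
  have szy : (size y <= size (x N))%N.
    rewrite (leq_trans (size_scale_leq _ _)) // (leq_trans (size_polyMleq _ _)) //.
    by rewrite size_polyXn addSn subnK.
  exists (y + z); split.
  - rewrite /y scalerAl; apply: ispan_cons => //; exact: memss.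
  - rewrite coefD zN coefZ coefXnM; congr (a * _ + _).
    have [xi0|xi0] := posnP (size (x i)).
      move/eqP: xi0; rewrite size_poly_eq0 => /eqP ->.
      by rewrite coef0 lead_coef0 if_same.
    rewrite lead_coefE -(prednK xi0) -(prednK (leq_trans xi0 lei)) subSS /=.
    rewrite ltnNge leq_subr /= subKn // -ltnS prednK // prednK //.
    exact: leq_trans xi0 lei.
  - by rewrite (leq_trans (size_polyD _ _)) // geq_max szy.
have : (size (x N) <= size (x N - z)%R)%N.
  apply: xmin; first by apply: ispanD => //; rewrite -mulN1r; apply: ispanM;
    apply: (ispan_sub (@ssS N)).
  move=> xz; apply: xN; rewrite -[x N](subrK z); exact: ispanD.
have xN0 : (0 < size (x N))%N.
  rewrite lt0n size_poly_eq0; apply/eqP => x0.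
  by apply: xN; rewrite x0; exact: ispan0.
rewrite leqNgt -[X in (_ < X)%N](prednK xN0) ltnS => /negP; apply.
apply/leq_sizeP => j; rewrite leq_eqVlt coefB => /orP[/eqP<-|].
  by rewrite zN -/(lead_coef _) subrr.
rewrite prednK // => jN.
by rewrite !nth_default ?subrr // (leq_trans zsz).
Qed.

(** Induction on [n]: evaluation at the last variable maps [{poly mpoly n k}] onto the polynomials
    in [n.+1] variables. *)
Lemma noetherian_mpoly (k : fieldType) (n : nat) : noetherian (mpoly n k).
Proof.
elim: n => [|n IHn].
  apply: (@noetherian_surj k _ (@mpolyC 0 k)); last exact: noetherian_field.
  - exact: mpolyC0.
  - exact: mpolyCD.
  - exact: mpolyCM.
  elim/mpoly_alg_ind => [c|[]//|p q [a <-] [b <-]|p q [a <-] [b <-]].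
  - by exists c.
  - by exists (a + b); rewrite mpolyCD.
  - by exists (a * b); rewrite mpolyCM.
pose x : mpoly n.+1 k := mpolyX k (mnm1 ord_max).
pose f (P : {poly mpoly n k}) := (map_poly (@mwiden n k) P).[x].
have fD : {morph f : P Q / P + Q}.
  by move=> P Q; rewrite /f rmorphD hornerD.
have fM : {morph f : P Q / P * Q}.
  by move=> P Q; rewrite /f rmorphM hornerM.
have fC p : f p%:P = mwiden p by rewrite /f map_polyC hornerC.
apply: (@noetherian_surj {poly mpoly n k} _ f) => //.
- by rewrite /f map_poly0 horner0.
- elim/mpoly_alg_ind => [c|i|p q [P <-] [Q <-]|p q [P <-] [Q <-]].
  + by exists (mpolyC n c)%:P; rewrite fC mwidenC.
  + case: (unliftP ord_max i) => [j|] ->.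
      exists (mpolyX k (mnm1 j))%:P; rewrite fC mwidenX mnmwiden1.
      by congr (mpolyX k (mnm1 _)); apply/val_inj; rewrite /= /bump leqNgt ltn_ord.
    by exists 'X; rewrite /f map_polyX hornerX.
  + by exists (P + Q).
  + by exists (P * Q).
exact: noetherian_poly.
Qed.

(** * Definable sets *)

Section Definable.
Context (k : closedFieldType) (E : Type) (env : E -> seq k).
Context (F : set (E -> k)) (C : set E).
Hypothesis F_cst : forall c : k, F (fun=> c).
Hypothesis FD : forall u v, F u -> F v -> F (fun x => u x + v x).
Hypothesis FM : forall u v, F u -> F v -> F (fun x => u x * v x).
Hypothesis F_env : forall i, F (fun x => (env x)`_i).
Hypothesis C_nonempty : C !=set0.
(** The ideal of [C] in the function ring [F] is prime, so the closure of [C] is irreducible. *)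
Hypothesis C_prime : forall u v, F u -> F v -> (forall x, C x -> u x * v x = 0) ->
  (forall x, C x -> u x = 0) \/ (forall x, C x -> v x = 0).

(** The Zariski closure of [C] with respect to the functions in [F]. *)
Definition fclosure : set E :=
  [set x | forall u, F u -> (forall y, C y -> u y = 0) -> u x = 0].

Lemma sub_fclosure : C `<=` fclosure.
Proof. by move=> x Cx u _; exact. Qed.

Lemma rterm_fun t : GRing.rterm t -> F (fun x => GRing.eval (env x) t).
Proof.
elim: t => //=.
- by move=> t1 IH1 t2 IH2 /andP[/IH1 ? /IH2 ?]; exact: FD.
- move=> t IH /IH Ft.
  have -> : (fun x => - GRing.eval (env x) t) =
            (fun x => -1 * GRing.eval (env x) t).
    by apply/funext => x; rewrite mulN1r.
  exact: FM.
- move=> t IH n /IH Ft.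
  have -> : (fun x => GRing.eval (env x) t *+ n) =
            (fun x => n%:R * GRing.eval (env x) t).
    by apply/funext => x; rewrite mulr_natl.
  exact: FM.
- by move=> t1 IH1 t2 IH2 /andP[/IH1 ? /IH2 ?]; exact: FM.
- move=> t IH n /IH Ft; elim: n => [|n IHn].
    by rewrite (_ : (fun _ => _) = (fun=> 1))//; exact: F_cst.
  rewrite (_ : (fun _ => _) =
    (fun x => GRing.eval (env x) t * GRing.eval (env x) t ^+ n)).
    exact: FM.
  by apply/funext => x; rewrite exprS.
Qed.

(** An equation either holds on all of [C], hence on its closure, or fails wherever the difference
    of its sides is nonzero. For binary connectives the witnesses [g] are multiplied, and primality
    keeps the product from vanishing on [C]. *)
Lemma qf_generic (f : GRing.formula k) : GRing.qf_form f -> GRing.rformula f ->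
  exists g b, [/\ F g, exists2 x, C x & g x != 0 &
    forall x, fclosure x -> g x != 0 -> GRing.qf_eval (env x) f = b].
Proof.
have [x0 Cx0] := C_nonempty.
have const (b : bool) (P : E -> bool) : (forall x, P x = b) ->
    exists g b, [/\ F g, exists2 x, C x & g x != 0 &
      forall x, fclosure x -> g x != 0 -> P x = b].
  move=> Pb; exists (fun=> 1), b; split=> //.
  by exists x0; rewrite ?oner_neq0.
have mul u v : F u -> F v -> (exists2 x, C x & u x != 0) ->
    (exists2 x, C x & v x != 0) -> exists2 x, C x & u x * v x != 0.
  move=> Fu Fv [x Cx ux] [y Cy vy]; apply: contrapT => uv.
  have [z Cz|/(_ x Cx) u0|/(_ y Cy) v0] := C_prime Fu Fv.
  - by apply/eqP/negPn/negP => uvz; apply: uv; exists z.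
  - by rewrite u0 eqxx in ux.
  - by rewrite v0 eqxx in vy.
have binary (op : bool -> bool -> bool) f1 f2 :
    (exists g b, [/\ F g, exists2 x, C x & g x != 0 &
      forall x, fclosure x -> g x != 0 -> GRing.qf_eval (env x) f1 = b]) ->
    (exists g b, [/\ F g, exists2 x, C x & g x != 0 &
      forall x, fclosure x -> g x != 0 -> GRing.qf_eval (env x) f2 = b]) ->
    exists g b, [/\ F g, exists2 x, C x & g x != 0 &
      forall x, fclosure x -> g x != 0 ->
        op (GRing.qf_eval (env x) f1) (GRing.qf_eval (env x) f2) = b].
  move=> [g1 [b1 [Fg1 g1n fb1]]] [g2 [b2 [Fg2 g2n fb2]]].
  exists (fun x => g1 x * g2 x), (op b1 b2); split; first exact: FM.
    exact: mul.
  move=> x Cx; rewrite mulf_eq0 negb_or => /andP[g1x g2x].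
  by rewrite fb1 // fb2.
elim: f => //=.
- by move=> b _ _; exact: (@const b).
- move=> t1 t2 _ /andP[rt1 rt2].
  pose d x := GRing.eval (env x) t1 - GRing.eval (env x) t2.
  have Fd : F d.
    have -> : d = fun x => GRing.eval (env x) (GRing.Add t1 (GRing.Opp t2)) by [].
    by apply: rterm_fun => /=; rewrite rt1.
  have [d0|/existsNP[x /not_implyP[Cx /eqP dx]]] := pselect (forall x, C x -> d x = 0).
    exists (fun=> 1), true; split; first exact: F_cst.
      by exists x0; rewrite ?oner_neq0.
    by move=> x /(_ d Fd d0)/eqP; rewrite subr_eq0.
  exists d, false; split=> //; first by exists x.
  by move=> y _; rewrite subr_eq0 => /negbTE.
- by move=> f1 IH1 f2 IH2 /andP[q1 q2] /andP[r1 r2]; apply: (binary andb); auto.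
- by move=> f1 IH1 f2 IH2 /andP[q1 q2] /andP[r1 r2]; apply: (binary orb); auto.
- move=> f1 IH1 f2 IH2 /andP[q1 q2] /andP[r1 r2].
  by apply: (binary (fun b c => b ==> c)); auto.
- move=> f IH qf rf; have [g [b [Fg gn fb]]] := IH qf rf.
  by exists g, (~~ b); split=> // x Cx gx; rewrite fb.
Qed.

(* Quantifier elimination plays the role of Chevalley's theorem. *)
Lemma definable_generic (f : GRing.formula k) : GRing.rformula f ->
    (forall x, C x -> GRing.holds (env x) f) ->
  exists g, [/\ F g, exists2 x, C x & g x != 0 &
    forall x, fclosure x -> g x != 0 -> GRing.holds (env x) f].
Proof.
move=> rf Cf.
pose kP : GRing.closed_field_axiom k := @solve_monicpoly k.
pose qe := GRing.quantifier_elim (@ClosedFieldQE.ex_elim k) f.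
have qeP e : reflect (GRing.holds e f) (GRing.qf_eval e qe).
  apply: GRing.quantifier_elim_rformP => //.
    exact: ClosedFieldQE.wf_ex_elim.
  exact: ClosedFieldQE.holds_ex_elim.
have /andP[qf rq] : GRing.qf_form qe && GRing.rformula qe.
  by apply: GRing.quantifier_elim_wf => //; exact: ClosedFieldQE.wf_ex_elim.
have [g [b [Fg [x Cx gx] gb]]] := qf_generic qf rq.
exists g; split=> //; first by exists x.
(* The generic truth value is the one taken at the point [x] of [C], where [f] holds. *)
move=> y Cy gy; apply/qeP; rewrite (gb y) // -(gb x) //; last exact: sub_fclosure.
exact/qeP/Cf.
Qed.

End Definable.

(** The shift [m] leaves the first [m] variables of a formula free for other quantities. *)
Lemma mpoly_term (k : fieldType) (n m : nat) (p : mpoly n k) :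
  exists t : GRing.term k, GRing.rterm t /\
    forall e, GRing.eval e t = meval (fun i : 'I_n => e`_(m + i)) p.
Proof.
elim/mpoly_alg_ind: p => [c|i|p q [t [rt tE]] [u [ru uE]]|p q [t [rt tE]] [u [ru uE]]].
- by exists (GRing.Const c); split=> // e; rewrite mevalC.
- by exists (GRing.Var k (m + i)); split=> // e; rewrite mevalXU.
- by exists (GRing.Add t u); split=> [|e] /=; rewrite ?rt // tE uE mevalD.
- by exists (GRing.Mul t u); split=> [|e] /=; rewrite ?rt // tE uE mevalM.
Qed.
(** * Immersions, charts and subvarieties *)

Section Immersions.
Context (k : closedFieldType).
Implicit Types X Y Z : fspace k.

Lemma open_near X (O : set X) x : open O -> O x -> \forall y \near x, O y.
Proof. by move=> oO Ox; apply: open_nbhs_nbhs; split. Qed.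

Lemma openP X (O : set X) : (forall x, O x -> nbhs x O) -> open O.
Proof. by rewrite openE. Qed.

Lemma near_subE X (A : set X) (a : subfspace A) (P : X -> Prop) :
  (\forall b \near a, P (val b)) <-> (\forall x \near val a, A x -> P x).
Proof.
split=> [aP|H]; last first.
  have := @sub_near k X A a (fun x => A x -> P x) H.
  by apply: filterS => b; apply; exact: set_valP.
have : nbhs a [set b | P (val b)] := aP.
rewrite nbhsE => -[V [[W oW WV] Va] VP].
apply: (@filterS _ (nbhs (val a)) _ W) => [x Wx Ax|].
  have := VP (SigSub (mem_set Ax)); apply.
  by rewrite -WV.
apply: open_near => //; by rewrite -WV in Va.
Qed.

Lemma near_sub_open X (O : set X) (a : subfspace O) (P : X -> Prop) : open O ->
  (\forall b \near a, P (val b)) -> \forall x \near val a, P x.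
Proof.
move=> oO /near_subE; apply: filter_app.
have := open_near oO (set_valP a); apply: filterS.
by move=> x Ox /(_ Ox).
Qed.

(** Maps are total on the carrier but often behave well only on an open set, hence a pointwise
    notion of morphism. *)
Definition mor_at X Y (f : X -> Y) (x : X) : Prop :=
  (forall P : Y -> Prop, (\forall y \near f x, P y) ->
    \forall z \near x, P (f z)) /\
  forall h, regular_at (f x) h -> regular_at x (h \o f).

Lemma fmorphismP X Y (f : X -> Y) : fmorphism f <-> forall x, mor_at f x.
Proof.
split=> [[cf rf] x|fm]; first by split=> [P /cf|h /rf].
by split=> [x P fP|x h]; [exact: (fm x).1 | exact: (fm x).2].
Qed.

Lemma mor_at_comp X Y Z (g : Y -> Z) (f : X -> Y) x :
  mor_at f x -> mor_at g (f x) -> mor_at (g \o f) x.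
Proof. by move=> [cf rf] [cg rg]; split=> [P /cg /cf|h /rg /rf]. Qed.

Lemma fmorphism_id X : fmorphism (@id X).
Proof. by apply/fmorphismP => x; split. Qed.

Lemma fmorphism_comp X Y Z (g : Y -> Z) (f : X -> Y) :
  fmorphism f -> fmorphism g -> fmorphism (g \o f).
Proof.
by move=> /fmorphismP fm /fmorphismP gm; apply/fmorphismP => x; exact: mor_at_comp.
Qed.

Lemma fmorphism_val X (A : set X) : fmorphism (val : subfspace A -> X).
Proof.
apply/fmorphismP => a; split=> [P aP|h ah]; first exact: sub_near.
by exists h => //; exact: filterE.
Qed.

(* [F] restricts to a locally closed immersion on [O]. *)
Record imm_on X Y (O : set X) (F : X -> Y) : Prop := ImmOn {
  imm_inj : forall x y, O x -> O y -> F x = F y -> x = y;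
  imm_mor : forall x, O x -> mor_at F x;
  imm_near : forall x (P : X -> Prop), O x -> (\forall y \near x, P y) ->
    \forall z \near F x, forall y, O y -> F y = z -> P y;
  imm_regular : forall x f, O x -> regular_at x f ->
    exists2 u, regular_at (F x) u & \forall y \near x, f y = u (F y)
}.

Lemma imm_on_comp X Y Z (P : set X) (O : set Y) (j : X -> Y) (F : Y -> Z) :
  imm_on P j -> imm_on O F -> j @` P `<=` O -> imm_on P (F \o j).
Proof.
move=> [ij mj nj rj] [iF mF nF rF] jO.
have jO' x : P x -> O (j x) by move=> Px; apply: jO; exists x.
split.
- by move=> x y Px Py /= /iF/ij; apply; auto.
- by move=> x Px; apply: mor_at_comp; auto.
- move=> x Q Px /(nj _ _ Px) /(nF _ _ (jO' _ Px)); apply: filterS => z zQ y Py /= yz.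
  exact: zQ (jO' _ Py) yz _ Py erefl.
- move=> x f Px /(rj _ _ Px)[u ju fu].
  have [v Fv uv] := rF _ _ (jO' _ Px) ju; exists v => //.
  have := (mj x Px).1 _ uv.
  by apply: filterS2 fu => y -> /= ->.
Qed.

Lemma imm_on_sub X Y (P O : set X) (F : X -> Y) :
  P `<=` O -> imm_on O F -> imm_on P F.
Proof.
move=> PO [iF mF nF rF]; split.
- by move=> x y /PO ? /PO ?; exact: iF.
- by move=> x /PO; exact: mF.
- move=> x Q /PO Ox /(nF _ _ Ox); apply: filterS => z zQ y /PO; exact: zQ.
- by move=> x f /PO; exact: rF.
Qed.

Lemma imm_on_val X (A : set X) : imm_on setT (val : subfspace A -> X).
Proof.
split.
- by move=> x y _ _; exact: val_inj.
- by move=> x _; apply: (fmorphismP _).1; exact: fmorphism_val.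
- move=> x P _ xP; have : nbhs x P := xP.
  rewrite nbhsE => -[V [[W oW WV] Vx] VP].
  have Wx : W (val x) by rewrite -WV in Vx.
  apply: filterS (open_near oW Wx) => z Wz y _ yz; apply: VP.
  by rewrite -WV /=; move: Wz; rewrite -yz.
- by move=> x f _ [g xg fg]; exists g.
Qed.

Lemma imm_on_fiso X Y (f : X -> Y) (g : Y -> X) :
  fmorphism f -> fmorphism g -> cancel f g -> imm_on setT f.
Proof.
move=> /fmorphismP fm /fmorphismP gm fK; split=> //.
- by move=> x y _ _; exact: can_inj fK _ _.
- move=> x P _ xP; have [cg _] := gm (f x); rewrite -{1}(fK x) in xP.
  by apply: filterS (cg _ xP) => z zP y _ yz; rewrite -(fK y) yz.
- move=> x h _ xh; have [_ rg] := gm (f x); rewrite -{1}(fK x) in xh.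
  exists (h \o g); first exact: rg.
  by apply: filterE => y /=; rewrite fK.
Qed.

(** Neighbourhoods and regular functions on [Y] come locally from [Z] through [l], so [f] can be
    tested through [j]. *)
Lemma imm_fmorphism X Y Z (j : X -> Z) (l : Y -> Z) (f : X -> Y) :
  fmorphism j -> imm_on setT l -> (forall x, l (f x) = j x) -> fmorphism f.
Proof.
move=> /fmorphismP mj [il ml nl rl] lf; apply/fmorphismP => x.
have cf (P : Y -> Prop) : (\forall y \near f x, P y) -> \forall z \near x, P (f z).
  move=> /(nl _ _ I); rewrite lf => /(mj x).1; apply: filterS => z; exact.
split=> // h /rl[//|u]; rewrite lf => /(mj x).2 xu hu.
by apply: regular_at_near xu; apply: filterS (cf _ hu) => z /= ->; rewrite lf.
Qed.

(** Each immersion factors through the other as a map of sets, and both factorizations are morphisms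
    by [imm_fmorphism]. *)
Lemma imm_fiso X Y Z (j : X -> Z) (l : Y -> Z) :
  imm_on setT j -> imm_on setT l -> range j = range l -> fiso X Y.
Proof.
move=> mj ml jl.
have mor (T : fspace k) (m : T -> Z) : imm_on setT m -> fmorphism m.
  by move=> [_ mm _ _]; apply/fmorphismP => x; exact: mm.
have /choice[f fP] : forall x, exists y, l y = j x.
  move=> x; have : range l (j x) by rewrite -jl; exists x.
  by move=> [y _ yx]; exists y.
have /choice[g gP] : forall y, exists x, j x = l y.
  move=> y; have : range j (l y) by rewrite jl; exists y.
  by move=> [x _ xy]; exists x.
exists f, g; split.
- exact: imm_fmorphism (mor _ _ mj) ml fP.
- exact: imm_fmorphism (mor _ _ ml) mj gP.
- by move=> x; apply: (imm_inj mj) => //; rewrite gP fP.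
- by move=> y; apply: (imm_inj ml) => //; rewrite fP gP.
Qed.

Lemma imm_val_eq X Y (j : X -> Y) (A : set Y) :
  imm_on setT j -> range j = A -> fiso X (subfspace A).
Proof.
move=> mj jA; apply: (imm_fiso mj (imm_on_val A)); rewrite jA.
apply/seteqP; split=> [y Ay|_ [y _ <-]]; last exact: set_valP.
by exists (SigSub (mem_set Ay)).
Qed.

Lemma fiso_imm X Y : fiso X Y -> exists2 f : X -> Y, imm_on setT f & range f = setT.
Proof.
move=> [f [g [fm gm fK gK]]]; exists f; first exact: imm_on_fiso gm fK.
by apply/seteqP; split=> // y _; exists (g y).
Qed.

Lemma fiso_sym X Y : fiso X Y -> fiso Y X.
Proof. by move=> [f [g [? ? ? ?]]]; exists g, f. Qed.

Lemma fiso_refl X : fiso X X.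
Proof. by exists id, id; split=> //; exact: fmorphism_id. Qed.

Lemma is_affineP X : is_affine X <-> exists n (F : X -> affine_space k n),
  imm_on setT F /\ closed (range F).
Proof.
split=> [[n [Z [cZ /fiso_imm[f mf rf]]]]|[n [F [mF cF]]]]; last first.
  by exists n, (range F); split; [exact: cF | exact: imm_val_eq mF erefl].
exists n, (val \o f); split; first by apply: imm_on_comp mf (imm_on_val Z) _.
suff -> : range (val \o f) = Z by [].
apply/seteqP; split=> [_ [x _ <-]|z Zz]; first exact: set_valP.
have : range f (SigSub (mem_set Zz)) by rewrite rf.
by move=> [x _ fx]; exists x => //=; rewrite fx.
Qed.

(** Replaces a map on the subspace type by a total map on [X], with junk value [y0] off [O];
    openness of [O] lets germs pass from the subspace to [X]. *)
Lemma extend_imm X Y (O : set X) (y0 : Y) (j : subfspace O -> Y) :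
  open O -> imm_on setT j -> exists2 F : X -> Y, imm_on O F & F @` O = range j.
Proof.
move=> oO [ij mj nj rj].
pose F x := if pselect (O x) is left Ox then j (SigSub (mem_set Ox)) else y0.
have FE (a : subfspace O) : F (val a) = j a.
  rewrite /F; case: pselect => [Oa|]; last by case; exact: set_valP.
  by congr j; exact: val_inj.
have FE' x (Ox : O x) : F x = j (SigSub (mem_set Ox)) by rewrite -FE.
exists F; last first.
  apply/seteqP; split=> [_ [x Ox <-]|_ [a _ <-]]; last first.
    by exists (val a); [exact: set_valP|rewrite FE].
  exists (SigSub (mem_set Ox)) => //; rewrite (FE' _ Ox).
split.
- move=> x y Ox Oy; rewrite (FE' _ Ox) (FE' _ Oy) => /ij.
  by move=> /(_ I I)/(congr1 val).
- move=> x Ox; set a : subfspace O := SigSub (mem_set Ox).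
  have [cj rj'] := mj a I; split=> [P|h]; rewrite (FE' _ Ox) -/a.
    move=> /cj aP; apply: (@near_sub_open _ _ a _ oO).
    by apply: filterS aP => b; rewrite FE.
  move=> /rj'[g ag jg]; apply: regular_at_near ag.
  apply: (@near_sub_open _ _ a _ oO).
  by apply: filterS jg => b /= <-; rewrite FE.
- move=> x P Ox xP; set a : subfspace O := SigSub (mem_set Ox).
  rewrite (FE' _ Ox) -/a; have := nj a (P \o val) I (sub_near (a := a) xP).
  apply: filterS => z zP y Oy; rewrite (FE' _ Oy) => yz.
  exact: (zP _ _ yz).
- move=> x f Ox xf; set a : subfspace O := SigSub (mem_set Ox).
  have [u ju fu] := rj a (f \o val) I ((fmorphism_val O).2 a f xf).
  rewrite (FE' _ Ox) -/a; exists u => //; apply: (@near_sub_open _ _ a _ oO).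
  by apply: filterS fu => b /= ->; rewrite FE.
Qed.

End Immersions.

(** * Morphisms to affine space and the Noetherian property *)

Section Varieties.
Context (k : closedFieldType).
Implicit Types X Y Z : fspace k.

(* Not an axiom of [fspace], but true on varieties. *)
Definition floc X : Prop := forall x (f : X -> k), regular_at x f -> f x != 0 ->
  (\forall y \near x, f y != 0) /\ regular_at x (fun y => (f y)^-1).

Lemma floc_affine n : floc (affine_space k n).
Proof.
move=> x f [p [q [qx fE]]] fx.
have px : peval p x != 0.
  by move: fx; rewrite (nbhs_singleton fE) mulf_eq0 negb_or => /andP[].
split; last by exists q, p; split=> //; apply: filterS fE => y ->; rewrite invf_div.
apply: filterS3 fE (near_neq0 px) (near_neq0 qx) => y -> py qy.
by rewrite mulf_neq0 // invr_eq0.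
Qed.

Lemma floc_imm X : (forall x, exists Y (O : set X) (F : X -> Y),
  [/\ floc Y, O x & imm_on O F]) -> floc X.
Proof.
move=> cX x f xf fx; have [Y [O [F [lY Ox [_ mF _ rF]]]]] := cX x.
have [u Fu fu] := rF _ _ Ox xf; have [cF rgF] := mF _ Ox.
have ux : u (F x) != 0 by rewrite -(nbhs_singleton fu).
have [un ui] := lY _ _ Fu ux; split.
  by apply: filterS2 fu (cF _ un) => y ->.
by apply: regular_at_near (rgF _ ui); apply: filterS fu => y /= ->.
Qed.

Lemma regular_at_peval X n (F : X -> affine_space k n) x (p : mpoly n k) :
  (forall i, regular_at x (fun y => (F y : 'rV[k]_n) ord0 i)) ->
  regular_at x (fun y => peval p (F y)).
Proof.
move=> rF; elim/mpoly_alg_ind: p => [c|i|p q rp rq|p q rp rq].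
- by rewrite (_ : (fun _ => _) = fun=> c); [exact: regular_at_cst|
    apply/funext => y; rewrite /peval mevalC].
- by rewrite (_ : (fun _ => _) = fun y => (F y : 'rV[k]_n) ord0 i) //;
    apply/funext => y; rewrite /peval mevalXU.
- by rewrite (_ : (fun _ => _) = fun y => peval p (F y) + peval q (F y));
    [exact: regular_atD|apply/funext => y; rewrite /peval mevalD].
- by rewrite (_ : (fun _ => _) = fun y => peval p (F y) * peval q (F y));
    [exact: regular_atM|apply/funext => y; rewrite /peval mevalM].
Qed.

Lemma affine_basic n (x : affine_space k n) (P : affine_space k n -> Prop) :
  (\forall y \near x, P y) ->
  exists2 q, peval q x != 0 & forall y, peval q y != 0 -> P y.
Proof.
move=> xP; have : nbhs x P := xP; rewrite nbhsE => -[V [/zariskiE oV Vx] VP].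
have [q qx qV] := (zariski_openP V).1 oV x Vx.
by exists q => // y /qV /VP.
Qed.

(** Basic open sets are nonvanishing loci and regular functions are quotients of polynomials; [floc]
    supplies the open nonvanishing loci and the inverses. *)
Lemma mor_at_affine X n (F : X -> affine_space k n) x : floc X ->
  (forall i, regular_at x (fun y => (F y : 'rV[k]_n) ord0 i)) -> mor_at F x.
Proof.
move=> lX rF.
have cF (P : affine_space k n -> Prop) :
    (\forall y \near F x, P y) -> \forall z \near x, P (F z).
  move=> /affine_basic[q qx qP].
  have [qn _] := lX _ _ (regular_at_peval q rF) qx.
  by apply: filterS qn => z; exact: qP.
split=> // h [p [q [qx hE]]].
have [qn qi] := lX _ _ (regular_at_peval q rF) qx.
apply: regular_at_near (regular_atM (regular_at_peval p rF) qi).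
by apply: filterS (cF _ hE) => z /= ->.
Qed.

Lemma regular_at_coord n (x : affine_space k n) (i : 'I_n) :
  regular_at x (fun y : affine_space k n => (y : 'rV[k]_n) ord0 i).
Proof.
exists (mpolyX k (mnm1 i)), 1; split; first by rewrite /peval meval1 oner_neq0.
by apply: filterE => y; rewrite /peval mevalXU meval1 divr1.
Qed.

Lemma mor_at_coord X n (F : X -> affine_space k n) x (i : 'I_n) : mor_at F x ->
  regular_at x (fun y => (F y : 'rV[k]_n) ord0 i).
Proof. by move=> [_ rF]; exact: rF _ (regular_at_coord _ i). Qed.

Lemma floc_open X (f : X -> k) (O : set X) : floc X -> open O ->
  (forall x, O x -> regular_at x f) -> open [set x | O x /\ f x != 0].
Proof.
move=> lX oO rf; apply: openP => x [Ox fx].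
by have [fn _] := lX _ _ (rf _ Ox) fx; apply: filterS2 (open_near oO Ox) fn.
Qed.

Definition noeth (X : topologicalType) : Prop := forall A : nat -> set X,
  (forall i, closed (A i)) -> (forall i, A i.+1 `<=` A i) ->
  exists N, forall i, (N <= i)%N -> A N `<=` A i.

Lemma decreasing_sub (T : Type) (A : nat -> set T) :
  (forall i, A i.+1 `<=` A i) -> forall i j, (i <= j)%N -> A j `<=` A i.
Proof.
move=> dA i j; elim: j => [|j IHj]; first by rewrite leqn0 => /eqP->.
by rewrite leq_eqVlt => /orP[/eqP->//|/IHj ji] x /dA /ji.
Qed.

Lemma peval_ispan n (S : set (mpoly n k)) (x : affine_space k n) p :
  (forall q, S q -> peval q x = 0) -> ispan S p -> peval p x = 0.
Proof.
move=> Sx; elim=> [|a q r Sq _ IHr]; first by rewrite /peval meval0.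
by rewrite /peval mevalD mevalM -/(peval q x) Sx // mulr0 add0r.
Qed.

Lemma closed_witness n (A : set (affine_space k n)) x : closed A -> ~ A x ->
  exists2 p, peval p x != 0 & forall y, A y -> peval p y = 0.
Proof.
move=> /closed_openC/zariskiE/(zariski_openP _).1 oA /oA[p px pA].
exists p => // y Ay; apply/eqP/negPn/negP => py; exact: (pA y py).
Qed.

(** The ideals [I i] increase, and finitely many generators of the ideal spanned by their union
    already lie in one [I N]. *)
Lemma noeth_affine n : noeth (affine_space k n).
Proof.
move=> A cA dA; pose I i := [set p : mpoly n k | forall x, A i x -> peval p x = 0].
have sA := decreasing_sub dA.
have [s [sI Is]] := @noetherian_mpoly k n (\bigcup_i I i).
have [N sN] : exists N, [set` s] `<=` I N.
  elim: s sI {Is} => [|p s IHs] sI; first by exists 0%N.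
  have [|N sN] := IHs.
    by move=> q qs; apply: sI; rewrite /= inE; apply/orP; right.
  have [|i _ pi] := sI p; first by rewrite /= inE eqxx.
  exists (maxn i N) => q; rewrite /= inE => /orP[/eqP->|qs] x Ax.
    by apply: pi; apply: sA Ax; exact: leq_maxl.
  by apply: (sN _ qs); apply: sA Ax; exact: leq_maxr.
exists N => i Ni x Ax; apply: contrapT => nAx.
have [p px pA] := closed_witness (cA i) nAx.
have sp : ispan [set` s] p by apply: Is; exists i.
rewrite (peval_ispan _ sp) ?eqxx // in px => q qs.
exact: (sN _ qs).
Qed.

(** On each piece the chain is replaced by the closures of its images in [Y]; [imm_near] recovers
    the original sets from these closures. The largest of the finitely many stages works
    everywhere. *)
Lemma noeth_imm X n (U : 'I_n -> set X) :
    (forall x, exists i, U i x) ->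
    (forall i, exists Y (F : X -> Y), noeth Y /\ imm_on (U i) F) -> noeth X.
Proof.
move=> UT Uimm A cA dA.
have /choice[N NP] : forall i, exists N, forall j, (N <= j)%N ->
    A N `&` U i `<=` A j.
  move=> i; have [Y [F [nY [iF mF nF rF]]]] := Uimm i.
  pose C j := closure (F @` (A j `&` U i)).
  have [j||N NC] := nY C; first exact: closed_closure.
    move=> j; apply: closureS => _ [x [Ax Ux] <-].
    by exists x => //; split=> //; exact: dA.
  exists N => j Nj x [Ax Ux]; apply: contrapT => nAx.
  have CFx : C j (F x) by apply: NC Nj _ _; apply: subset_closure; exists x.
  have xA : \forall y \near x, ~ A j y.
    by apply: open_near => //; exact: closed_openC.
  have [_ [[y [Ay Uy] <-]] /(_ _ Uy erefl)] := CFx _ (nF _ _ Ux xA).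
  exact.
exists (\max_i N i) => j Nj x Ax; have [i Ux] := UT x.
apply: (NP i) => //; first exact: leq_trans (leq_bigmax i) Nj.
split=> //; apply: (decreasing_sub dA) Ax; exact: leq_bigmax.
Qed.

Lemma noeth_min (X : topologicalType) (F : set (set X)) : noeth X ->
    (forall A, F A -> closed A) -> F !=set0 ->
  exists2 A, F A & forall B, F B -> B `<=` A -> A `<=` B.
Proof.
move=> nX cF [A0 FA0]; apply: contrapT => nF.
have /choice[nxt nxtP] : forall A, exists B, F A ->
    [/\ F B, B `<=` A & ~ (A `<=` B)].
  move=> A; have [FA|] := pselect (F A); last by exists set0.
  apply: contrapT => nB; apply: nF; exists A => // B FB BA.
  by apply: contrapT => AB; apply: nB; exists B.
pose A n := iter n nxt A0.
have FA n : F (A n) by elim: n => //= n IHn; case: (nxtP _ IHn).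
have [n|n|N NP] := nX A; first exact: cF.
  by case: (nxtP _ (FA n)).
by case: (nxtP _ (FA N)) => _ _; apply; exact: (NP N.+1).
Qed.

Lemma noeth_closed_ind (X : topologicalType) (P : set X -> Prop) : noeth X ->
    (forall A, closed A -> (forall B, closed B -> B `<=` A -> ~ (A `<=` B) -> P B) ->
      P A) ->
  forall A, closed A -> P A.
Proof.
move=> nX IH A cA; apply: contrapT => nPA.
have [||B [cB nPB] minB] := @noeth_min _ [set B | closed B /\ ~ P B] nX.
- by move=> B [].
- by exists A.
apply: nPB; apply: IH => // C cC CB nBC; apply: contrapT => nPC.
by apply: nBC; exact: minB.
Qed.

(** Quasi-compactness as an induction principle: an open subset of [O] with [P] whose complement is
    minimal cannot be enlarged, so it is all of [O]. *)
Lemma noeth_open_ind (X : topologicalType) (O : set X) (P : set X -> Prop) :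
    noeth X -> P set0 -> (forall A B, P A -> P B -> P (A `|` B)) ->
    (forall x, O x -> exists N, [/\ open N, N x, N `<=` O & P N]) ->
  P O.
Proof.
move=> nX P0 PU loc.
have [||C [N [oN NO PN] <-] minC] := @noeth_min _
    [set ~` N | N in [set N | [/\ open N, N `<=` O & P N]]] nX.
- by move=> _ [N [oN _ _] <-]; exact: open_closedC.
- by exists (~` set0); exists set0 => //; split=> //; exact: open0.
suff ON : O `<=` N by rewrite (_ : O = N) //; apply/seteqP.
move=> x Ox; have [M [oM Mx MO PM]] := loc x Ox.
apply: contrapT => nNx.
have : ~` N `<=` ~` (N `|` M).
  apply: minC; last by apply: subsetC => y; left.
  exists (N `|` M) => //; split; [exact: openU| |exact: PU].
  by move=> y [/NO|/MO].
by move=> /(_ x nNx); apply; right.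
Qed.

End Varieties.

(** * Affine charts, and locally closed subsets as varieties *)

Section VarietyCharts.
Context (k : closedFieldType).
Implicit Types X Y Z : fspace k.

Definition affine_chart X (O : set X) n (F : X -> affine_space k n) : Prop :=
  [/\ open O, imm_on O F & closed (F @` O)].

Lemma is_variety_cover X : is_variety X -> exists n (U : 'I_n -> set X),
  (forall x, exists i, U i x) /\
  forall i, exists m (F : X -> affine_space k m), affine_chart (U i) F.
Proof.
move=> [[n [U [oU UT aU]]] _]; exists n, U; split=> [x|i].
  have : (\bigcup_i U i) x by rewrite UT.
  by move=> [i _ Ux]; exists i.
have [m [F [mF cF]]] := (is_affineP _).1 (aU i).
have [F' mF' FF'] := extend_imm (Y := affine_space k m) (0 : 'rV[k]_m) (oU i) mF.
by exists m, F'; split=> //; rewrite FF'.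
Qed.

Lemma variety_chart X : is_variety X -> forall x, exists n (O : set X)
  (F : X -> affine_space k n), O x /\ affine_chart O F.
Proof.
move=> /is_variety_cover[n [U [UT cU]]] x; have [i Ux] := UT x.
by have [m [F cF]] := cU i; exists m, (U i), F.
Qed.

Lemma floc_variety X : is_variety X -> floc X.
Proof.
move=> vX; apply: floc_imm => x; have [n [O [F [Ox [_ mF _]]]]] := variety_chart vX x.
by exists (affine_space k n), O, F; split=> //; exact: floc_affine.
Qed.

Lemma noeth_variety X : is_variety X -> noeth X.
Proof.
move=> /is_variety_cover[n [U [UT cU]]]; apply: (noeth_imm UT) => i.
have [m [F [_ mF _]]] := cU i; exists (affine_space k m), F.
by split=> //; exact: noeth_affine.
Qed.

Lemma tens_slice X Y (s : seq ((X -> k) * (Y -> k))) x y :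
  tens_regular_at s (x, y) -> regular_at y (fun y' => tens s (x, y')).
Proof.
elim: s => [_|ab s IHs rs].
  rewrite (_ : (fun _ => _) = fun=> 0); first exact: regular_at_cst.
  by apply/funext => y'; rewrite /tens big_nil.
rewrite (_ : (fun _ => _) = fun y' => ab.1 x * ab.2 y' + tens s (x, y')).
  apply: regular_atD.
    apply: regular_atM; first exact: regular_at_cst.
    by have [] := rs ab; rewrite ?inE ?eqxx.
  by apply: IHs => cd cds; apply: rs; rewrite inE cds orbT.
by apply/funext => y'; rewrite /tens big_cons.
Qed.

Lemma open_slice X Y (W : set (prod_fspace X Y)) (x : X) : floc Y -> open W ->
  open [set y | W (x, y)].
Proof.
move=> lY /fpairE oW; apply: openP => y /oW[U [V [s [oU oV rs [/= Ux Vy sxy] sW]]]].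
have [sn _] := lY _ _ (tens_slice (rs (x, y) Ux Vy)) sxy.
by apply: filterS2 (open_near oV Vy) sn => y' Vy' sy'; apply: sW; split.
Qed.

(** A singleton is a slice of the diagonal, which is closed by separatedness. *)
Lemma closed_point X : is_variety X -> forall x : X, closed [set x].
Proof.
move=> vX x; have /(@closed_openC (prod_fspace X X)) := vX.2.
move=> /(@open_slice X X _ x (floc_variety vX))/open_closedC.
rewrite (_ : ~` _ = [set x]) //; apply/seteqP; split=> y /=.
  by move=> /contrapT.
by move=> ->; exact.
Qed.

Lemma separated_inj X Y (j : X -> Y) : injective j -> fmorphism j ->
  closed [set z : prod_fspace Y Y | z.1 = z.2] ->
  closed [set z : prod_fspace X X | z.1 = z.2].
Proof.
move=> ij [cj rj] /(@closed_openC (prod_fspace Y Y))/fpairE oD.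
rewrite -[X in closed X]setCK; apply: (@open_closedC (prod_fspace X X)).
apply/fpairE => z /= nz.
have [|U [V [s [oU oV rs [/= Uz Vz sz] sW]]]] := oD (j z.1, j z.2).
  by move=> /= /ij.
pose s' := [seq (ab.1 \o j, ab.2 \o j) | ab <- s].
have s'E w : tens s' w = tens s (j w.1, j w.2) by rewrite /tens big_map.
exists (j @^-1` U), (j @^-1` V), s'; split.
- by apply: open_comp => // x _; exact: cj.
- by apply: open_comp => // x _; exact: cj.
- move=> w Uw Vw _ /mapP[ab /(rs (j w.1, j w.2) Uw Vw)[ra rb] ->].
  by split; exact: rj.
- by split=> //; rewrite s'E.
- move=> w [Uw Vw]; rewrite s'E => sw wE.
  by apply: (sW (j w.1, j w.2)) => //=; rewrite wE.
Qed.

(** Serves to add coordinates to an immersion: what is required of [G] is pulled back along the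
    projection [p]. *)
Lemma imm_on_factor X Y Z (D : set X) (F : X -> Y) (G : X -> Z) (p : Z -> Y) :
  imm_on D F -> (forall x, p (G x) = F x) -> (forall x, D x -> mor_at G x) ->
  fmorphism p -> imm_on D G.
Proof.
move=> [iF mF nF rF] pG mG /fmorphismP mp; split=> //.
- by move=> x y Dx Dy Gxy; apply: iF => //; rewrite -!pG Gxy.
- move=> x P Dx /(nF _ _ Dx); rewrite -pG => /(mp (G x)).1.
  by apply: filterS => z zP y Dy yz; apply: zP => //; rewrite -pG yz.
- move=> x f Dx /(rF _ _ Dx)[u]; rewrite -pG => /(mp (G x)).2 pu fu.
  by exists (u \o p) => //; apply: filterS fu => y ->; rewrite /= pG.
Qed.

Lemma closed_imm_image X Y (O A : set X) (F : X -> Y) : imm_on O F ->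
  closed (F @` O) -> closed A -> closed (F @` (O `&` A)).
Proof.
move=> [iF mF nF rF] cFO cA z cz.
have [x Ox xz] : (F @` O) z.
  by apply: cFO; apply: closureS cz => _ [x [Ox _] <-]; exists x.
exists x => //; split=> //; apply: contrapT => nAx.
have xA : \forall y \near x, ~ A y by apply: open_near => //; exact: closed_openC.
have := nF _ _ Ox xA; rewrite xz => /cz[_ [[y [Oy Ay] <-]] /(_ y Oy erefl)].
exact.
Qed.

(* The principal open subset [q != 0] of a chart is affine: adjoin the
   coordinate [1 / q]. *)
Lemma principal_chart X (O : set X) n (F : X -> affine_space k n) (q : mpoly n k) :
    floc X -> affine_chart O F ->
  exists G : X -> affine_space k (n + 1),
    affine_chart [set x | O x /\ peval q (F x) != 0] G.
Proof.
move=> lX [oO mF cF]; set D := [set x | _].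
have DO : D `<=` O by move=> x [].
have rq x : O x -> regular_at x (fun y => peval q (F y)).
  by move=> Ox; apply: regular_at_peval => i; apply: mor_at_coord; exact: imm_mor Ox.
have oD : open D by exact: floc_open.
pose G x : affine_space k (n + 1) :=
  row_mx (F x : 'rV[k]_n) (const_mx (peval q (F x))^-1 : 'rV[k]_1).
pose p (z : affine_space k (n + 1)) : affine_space k n := lsubmx (z : 'rV[k]_(n + 1)).
pose c (z : affine_space k (n + 1)) : k := (z : 'rV[k]_(n + 1)) ord0 (rshift n ord0).
have pG x : p (G x) = F x by rewrite /p /G row_mxKl.
have cG x : c (G x) = (peval q (F x))^-1 by rewrite /c /G row_mxEr mxE.
have lA := @floc_affine k.
have rc z : regular_at z c by exact: regular_at_coord.
have mp : fmorphism p.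
  apply/fmorphismP => z; apply: mor_at_affine => // i.
  rewrite (_ : (fun _ => _) = fun y : affine_space k (n + 1) =>
    (y : 'rV[k]_(n + 1)) ord0 (lshift 1 i)); first exact: regular_at_coord.
  by apply/funext => y; rewrite mxE.
have mG x : D x -> mor_at G x.
  move=> [Ox qx]; apply: mor_at_affine => // i.
  have [j ->|j ->] := split_ordP i.
    rewrite (_ : (fun _ => _) = fun y => (F y : 'rV[k]_n) ord0 j).
      by apply: mor_at_coord; exact: imm_mor Ox.
    by apply/funext => y; rewrite row_mxEl.
  rewrite (_ : (fun _ => _) = fun y => (peval q (F y))^-1).
    by have [_] := lX _ _ (rq _ Ox) qx.
  by apply/funext => y; rewrite row_mxEr mxE.
have mDG : imm_on D G by apply: imm_on_factor (imm_on_sub DO mF) pG mG mp.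
exists G; split=> //.
(* Over the closed image of [O], the image of [D] is the hypersurface on which the new coordinate
   [c] times [q] equals [1]. *)
have -> : G @` D = [set z | (F @` O) (p z) /\ c z * peval q (p z) = 1].
  apply/seteqP; split=> [_ [x [Ox qx] <-]|z [[x Ox xz] cz]].
    by rewrite /= pG cG mulVf //; split=> //; exists x.
  have qx : peval q (F x) != 0.
    by rewrite xz; apply: contra_eq_neq cz => ->; rewrite mulr0 eq_sym oner_neq0.
  exists x => //; apply/rowP => i; rewrite /G.
  have [j ->|j ->] := split_ordP i; first by rewrite row_mxEl xz mxE.
  rewrite row_mxEr mxE ord1; apply: (mulIf qx).
  by rewrite mulVf // xz -/(c z) cz.
rewrite -[X in closed X]setCK; apply: open_closedC; apply: openP => z nz.
have [pz|npz] := pselect ((F @` O) (p z)); last first.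
  have : \forall y \near p z, ~ (F @` O) y.
    by apply: open_near => //; exact: closed_openC.
  move=> /((fmorphismP _).1 mp z).1; apply: filterS => y ny [Fy _].
  exact: ny Fy.
have cz : c z * peval q (p z) - 1 != 0.
  by rewrite subr_eq0; apply/eqP => cz; exact: nz.
have rcz : regular_at z (fun y => c y * peval q (p y) - 1).
  apply: regular_atD; last exact: regular_at_cst.
  apply: regular_atM => //; apply: regular_at_peval => i; apply: mor_at_coord.
  exact: ((fmorphismP _).1 mp).
have [cn _] := lA _ _ _ rcz cz.
by apply: filterS cn => y; rewrite subr_eq0 => /eqP ny [_ /ny].
Qed.

(** Seen in a chart around [x], the set [N] contains a principal open subset through [x], which is
    affine by [principal_chart]. *)
Lemma chart_basis X (x : X) (N : set X) : is_variety X -> open N -> N x ->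
  exists n (O : set X) (F : X -> affine_space k n),
    [/\ O x, O `<=` N & affine_chart O F].
Proof.
move=> vX oN Nx; have [n [O [F [Ox cF]]]] := variety_chart vX x.
have [oO mF cFO] := cF.
have [q qx qN] := affine_basic (imm_near mF Ox (open_near oN Nx)).
have [G cG] := principal_chart q (floc_variety vX) cF.
exists (n + 1)%N, [set x | O x /\ peval q (F x) != 0], G; split=> //.
by move=> y [Oy qy]; exact: qN qy _ Oy erefl.
Qed.

(** [O] and [N] are kept apart because the induction in [open_chart_covered] varies [N] while the
    charts stay inside a fixed [O]. *)
Definition chart_covered X (O N : set X) : Prop := exists n (U : 'I_n -> set X),
  (forall x, N x -> exists i, U i x) /\
  forall i, U i `<=` O /\ exists m (F : X -> affine_space k m), affine_chart (U i) F.

Lemma open_chart_covered X (O : set X) : is_variety X -> open O ->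
  chart_covered O O.
Proof.
move=> vX oO; apply: noeth_open_ind (noeth_variety vX) _ _ _.
- by exists 0%N, (fun=> set0); split=> // -[].
- move=> A B [n [U [AU cU]]] [m [V [BV cV]]].
  pose W (i : 'I_(n + m)) := match fintype.split i with inl j => U j | inr j => V j end.
  exists (n + m)%N, W; split=> [x [/AU[i Ui]|/BV[i Vi]]|i].
  + by exists (unsplit (inl i)); rewrite /W unsplitK.
  + by exists (unsplit (inr i)); rewrite /W unsplitK.
  + by rewrite /W; case: (fintype.split i).
- move=> x Ox; have [n [N [F [Nx NO cF]]]] := chart_basis vX oO Ox.
  have [oN _ _] := cF; exists N; split=> //.
  exists 1%N, (fun=> N); split=> [y Ny|_]; first by exists ord0.
  by split=> //; exists n, F.
Qed.

(** Finitely many affine charts inside [O] cover it, and each carries its part of [A] to a closed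
    subset of affine space. The diagonal stays closed by [separated_inj]. *)
Lemma is_variety_sub X (A O : set X) : is_variety X -> closed A -> open O ->
  is_variety (subfspace (O `&` A)).
Proof.
move=> vX cA oO; split; last first.
  apply: (@separated_inj (subfspace (O `&` A)) X val).
  - exact: val_inj.
  - exact: fmorphism_val.
  - exact: vX.2.
have [n [U [OU cU]]] := open_chart_covered vX oO.
pose v : subfspace (O `&` A) -> X := val.
exists n, (fun i => v @^-1` U i); split=> [i||i].
- have [_ [m [F [oU _ _]]]] := cU i.
  by apply: open_comp => // a _; exact: (fmorphism_val _).1.
- apply/seteqP; split=> // a _; have [Oa _] := set_valP a.
  by have [i Ui] := OU _ Oa; exists i.
have [UO [m [F cF]]] := cU i; have [oU mF cFU] := cF.
apply/is_affineP; exists m, (F \o (v \o val)).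
have rv : range (v \o val : subfspace (v @^-1` U i) -> X) = U i `&` A.
  apply/seteqP; split=> [_ [b _ <-]|x [Ux Ax]].
    by split; [exact: (set_valP b)|have [] := set_valP (val b)].
  have OAx : (O `&` A) x by split=> //; exact: UO.
  by exists (SigSub (mem_set (Ux : (v @^-1` U i) (SigSub (mem_set OAx))))).
have mv : imm_on setT (v \o val : subfspace (v @^-1` U i) -> X).
  by apply: imm_on_comp (imm_on_val _) (imm_on_val _) _.
split; first by apply: imm_on_comp mv mF _; rewrite rv => x [].
have -> : range (F \o (v \o val) : subfspace (v @^-1` U i) -> _) =
    F @` (U i `&` A).
  rewrite -rv; apply/seteqP; split=> [_ [b _ <-]|_ [_ [b _ <-] <-]].
    by exists (v (val b)) => //; exists b.
  by exists b.
exact: closed_imm_image.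
Qed.

Lemma is_variety_open X (O : set X) : is_variety X -> open O ->
  is_variety (subfspace O).
Proof. by move=> vX oO; rewrite -[O]setIT; apply: is_variety_sub => //; exact: closedT. Qed.

Lemma is_variety_closed X (A : set X) : is_variety X -> closed A ->
  is_variety (subfspace A).
Proof. by move=> vX cA; rewrite -[A]setTI; apply: is_variety_sub => //; exact: openT. Qed.

End VarietyCharts.
(** * Generic regularity in characteristic zero *)

Section DefinableImage.
Context (k : closedFieldType).
Implicit Types X Y Z : fspace k.

Lemma closed_zeros n (A : set (affine_space k n)) : closed A ->
  exists s : seq (mpoly n k), forall x, A x <-> forall q, q \in s -> peval q x = 0.
Proof.
move=> cA; pose I := [set p : mpoly n k | forall x, A x -> peval p x = 0].
have [s [sI Is]] := @noetherian_mpoly k n I.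
exists s => x; split=> [Ax q qs|sx]; first exact: (sI q).
apply: contrapT => nAx; have [p px pA] := closed_witness cA nAx.
by rewrite (peval_ispan sx (Is _ pA)) eqxx in px.
Qed.

Lemma holds_all (T : eqType) (s : seq T) (phi : T -> GRing.formula k) e :
  GRing.holds e (foldr (fun x => GRing.And (phi x)) (GRing.Bool true) s) <->
  forall x, x \in s -> GRing.holds e (phi x).
Proof.
elim: s => [|x s IHs] /=; first by split.
split=> [[ex /IHs es] y|H]; first by rewrite inE => /orP[/eqP->|/es].
split; first by apply: H; rewrite inE eqxx.
by apply/IHs => y ys; apply: H; rewrite inE ys orbT.
Qed.

Lemma rformula_all (T : eqType) (s : seq T) (phi : T -> GRing.formula k) :
  (forall x, GRing.rformula (phi x)) ->
  GRing.rformula (foldr (fun x => GRing.And (phi x)) (GRing.Bool true) s).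
Proof. by move=> rphi; elim: s => //= x s ->; rewrite rphi. Qed.

(** In an affine chart the [a i] are quotients [P i / Q i]. A tuple [e] is then a value exactly when
    some point [w] satisfies the chart equations, [B w != 0] and [e_i * Q i w = P i w]. Variables
    below [n] hold [e]; the next [m], which are quantified, hold [w]. *)
Lemma definable_image X (x0 : X) (O' : set X) n (a : 'I_n -> X -> k) :
    is_variety X -> open O' -> O' x0 -> (forall i, regular_at x0 (a i)) ->
  exists N f, [/\ open N, N x0, N `<=` O', GRing.rformula f &
    forall e, size e = n ->
      GRing.holds e f <-> exists2 y, N y & forall i : 'I_n, a i y = e`_i].
Proof.
move=> vX oO' O'x ra; have [m [O [G [Ox OO' cG]]]] := chart_basis vX oO' O'x.
have [oO mG cGO] := cG.
have /choice[P /choice[Q PQ]] : forall i, exists P Q, peval Q (G x0) != 0 /\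
    \forall y \near x0, a i y * peval Q (G y) = peval P (G y).
  move=> i; have [u [P [Q [Qx uE]]] au] := imm_regular mG Ox (ra i).
  exists P, Q; split=> //; have cGx := (imm_mor mG Ox).1.
  apply: filterS3 au (cGx _ uE) (cGx _ (near_neq0 Qx)) => y -> -> Qy.
  by rewrite divfK.
have nPQ : \forall y \near x0, forall i, a i y * peval (Q i) (G y) = peval (P i) (G y).
  by apply: filter_forall => i; exact: (PQ i).2.
have [b bx bP] := affine_basic (imm_near mG Ox nPQ).
(* Where [b] is nonzero the relations between [a i], [P i] and [Q i] hold; where the [Q i] are
   nonzero they determine [a i]. *)
pose B := b * \prod_i Q i.
have BE w : peval B w = peval b w * \prod_i peval (Q i) w.
  by rewrite /B /peval mevalM rmorph_prod.
pose N := [set y | O y /\ peval B (G y) != 0].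
have Bx : peval B (G x0) != 0.
  by rewrite BE mulf_neq0 //; apply/prodf_neq0 => i _; exact: (PQ i).1.
have oN : open N.
  apply: floc_open (floc_variety vX) oO _ => x Ox'; apply: regular_at_peval => i.
  by apply: mor_at_coord; exact: imm_mor Ox'.
have [s sE] := closed_zeros cGO.
have /choice[tm tmP] := fun p : mpoly m k => mpoly_term n p.
pose phi1 q := GRing.Equal (tm q) (GRing.Const 0).
pose phi2 (i : 'I_n) := GRing.Equal (GRing.Mul (GRing.Var k i) (tm (Q i))) (tm (P i)).
pose psi := GRing.And (foldr (fun q => GRing.And (phi1 q)) (GRing.Bool true) s)
  (GRing.And (GRing.Not (phi1 B))
    (foldr (fun i => GRing.And (phi2 i)) (GRing.Bool true) (enum 'I_n))).
exists N, (foldr GRing.Exists psi (iota n m)); split=> //.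
- by move=> y [/OO'].
- have rt p : GRing.rterm (tm p) by have [] := tmP p.
  have : GRing.rformula psi.
    by rewrite /= !rformula_all //= => [|q|i]; rewrite ?rt.
  by elim: (iota n m) => //= i l IHl /IHl.
move=> e en; rewrite -GRing.foldExistsP; split.
  move=> [e' ee' [/holds_all e's [e'B /holds_all e'PQ]]].
  pose w : affine_space k m := \row_i e'`_(n + i).
  have ew p : GRing.eval e' (tm p) = peval p w.
    have [_ ->] := tmP p; apply: meval_eq => i; by rewrite mxE.
  have Bw : peval B w != 0 by apply/eqP; rewrite -ew.
  have [y Oy yw] : (G @` O) w by apply/sE => q /e's /=; rewrite ew.
  exists y => [|i]; first by split=> //; rewrite yw.
  move: (Bw); rewrite BE mulf_eq0 negb_or => /andP[bw /prodf_neq0/(_ i isT) Qw].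
  apply: (mulIf Qw); rewrite -{1}yw (bP w bw y Oy yw i) yw -ew.
  have := e'PQ i; rewrite mem_enum => /(_ isT) /= <-.
  rewrite ew ee' // !inE mem_iota negb_and -ltnNge.
  by rewrite ltn_ord.
move=> [y [Oy By] ay].
pose e' := e ++ [seq (G y : 'rV[k]_m) ord0 i | i <- enum 'I_m].
have ew p : GRing.eval e' (tm p) = peval p (G y).
  have [_ ->] := tmP p; apply: meval_eq => i.
  rewrite nth_cat en ltnNge leq_addr /= addKn (nth_map i) ?size_enum_ord //.
  by rewrite nth_ord_enum.
exists e' => [i|].
  (* Outside the quantified block the environments agree: below [n] by construction, and from
     [n + m] on because both lists have run out and give the default [0]. *)
  rewrite !inE mem_iota negb_and -ltnNge -leqNgt /e' nth_cat en => /orP[->//|nmi].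
  rewrite ltnNge (leq_trans (leq_addr m n) nmi) /= !nth_default //.
    by rewrite size_map size_enum_ord leq_subRL // (leq_trans (leq_addr m n)).
  by rewrite en (leq_trans (leq_addr m n)).
split; first by apply/holds_all => q qs /=; rewrite ew; apply: (sE (G y)).1 => //; exists y.
split; first by rewrite /= ew; apply/eqP.
apply/holds_all => i _ /=; rewrite !ew nth_cat en ltn_ord -ay.
move: By; rewrite BE mulf_eq0 negb_or => /andP[bw _].
exact: bP bw y Oy erefl i.
Qed.

End DefinableImage.

(** * Functions that become regular after pullback along a quotient map *)

Section GenericRegularity.
Context (k : closedFieldType).
Implicit Types X Y Z : fspace k.

Definition quotient_map X Z (p : X -> Z) : Prop :=
  [/\ fmorphism p, range p = setT & forall W, open (p @^-1` W) -> open W].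

(* The empty space qualifies. *)
Definition irreducible (Z : topologicalType) : Prop :=
  forall U V : set Z, open U -> open V -> U !=set0 -> V !=set0 -> U `&` V !=set0.

(** Polynomial functions on the product of affine space with a line, whose coordinate [x.2] carries
    the value of [h]. *)
Definition pfun n (P : {poly mpoly n k}) (x : affine_space k n * k) : k :=
  (map_poly (meval (fun i => (x.1 : 'rV[k]_n) ord0 i)) P).[x.2].

Lemma pfunM n (P Q : {poly mpoly n k}) x : pfun (P * Q) x = pfun P x * pfun Q x.
Proof. by rewrite /pfun rmorphM hornerM. Qed.

Lemma pfunC n (p : mpoly n k) x : pfun p%:P x = peval p x.1.
Proof. by rewrite /pfun map_polyC hornerC. Qed.

Lemma regular_at_pfun X n (P : {poly mpoly n k}) (F : X -> affine_space k n)
    (h : X -> k) x : mor_at F x -> regular_at x h ->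
  regular_at x (fun y => pfun P (F y, h y)).
Proof.
move=> mF rh; elim/poly_ind: P => [|P c IHP].
  rewrite (_ : (fun _ => _) = fun=> 0); first exact: regular_at_cst.
  by apply/funext => y; rewrite /pfun map_poly0 horner0.
rewrite (_ : (fun _ => _) =
    fun y => pfun P (F y, h y) * h y + peval c (F y)); last first.
  by apply/funext => y; rewrite /pfun rmorphD rmorphM /= map_polyX map_polyC hornerMXaddC.
apply: regular_atD; first exact: regular_atM.
by apply: regular_at_peval => i; exact: mor_at_coord.
Qed.

(** Irreducibility of [Z] makes the ideal of the graph of [h] prime. Part of the graph is definable
    through [X], so generic points of its closure lie on the graph, as [generic_value_rational]
    requires. *)
Lemma generic_regular X Z (p : X -> Z) (O' : set Z) (h : Z -> k) :
    [pchar k] =i pred0 -> is_variety X -> is_variety Z -> quotient_map p ->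
    irreducible Z -> open O' -> O' !=set0 ->
    (forall x, O' (p x) -> regular_at x (h \o p)) ->
  exists V, [/\ open V, V !=set0, V `<=` O' & forall z, V z -> regular_at z h].
Proof.
move=> k0 vX vZ [mp sp qp] iZ oO' [z0 O'z0] rh.
have [n [O [F [Oz0 OO' [oO mF _]]]]] := chart_basis vZ oO' O'z0.
have lX := floc_variety vX; have lZ := floc_variety vZ.
have mp' := (fmorphismP _).1 mp.
pose T : Type := (affine_space k n * k)%type.
pose gr z : T := (F z, h z).
pose Fn : set (T -> k) := range (@pfun n).
have Fn_cst c : Fn (fun=> c).
  by exists (mpolyC n c)%:P => //; apply/funext => x; rewrite pfunC /peval mevalC.
have FnD u v : Fn u -> Fn v -> Fn (fun x => u x + v x).
  move=> [P _ <-] [Q _ <-]; exists (P + Q) => //; apply/funext => x.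
  by rewrite /pfun rmorphD hornerD.
have FnM u v : Fn u -> Fn v -> Fn (fun x => u x * v x).
  move=> [P _ <-] [Q _ <-]; exists (P * Q) => //; apply/funext => x.
  by rewrite pfunM.
pose env (x : T) := rcons [seq (x.1 : 'rV[k]_n) ord0 i | i <- enum 'I_n] x.2.
have size_env x : size (env x) = n.+1 by rewrite size_rcons size_map size_enum_ord.
have env_coord x (i : 'I_n) : (env x)`_i = (x.1 : 'rV[k]_n) ord0 i.
  rewrite nth_rcons size_map size_enum_ord ltn_ord (nth_map i) ?size_enum_ord //.
  by rewrite nth_ord_enum.
have env_last x : (env x)`_n = x.2.
  by rewrite nth_rcons size_map size_enum_ord ltnn eqxx.
have Fn_env i : Fn (fun x => (env x)`_i).
  have [lt_in|le_ni] := ltnP i n.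
    exists (mpolyX k (mnm1 (Ordinal lt_in)))%:P => //; apply/funext => x.
    by rewrite pfunC /peval mevalXU -(env_coord x (Ordinal lt_in)).
  have [->|ne_in] := eqVneq i n.
    exists 'X => //; apply/funext => x.
    by rewrite /pfun map_polyX hornerX env_last.
  exists 0 => //; apply/funext => x; rewrite /pfun map_poly0 horner0 nth_default //.
  by rewrite size_env ltn_neqAle eq_sym ne_in.
pose vanish (u : T -> k) := forall z, O z -> u (gr z) = 0.
(* No regularity of [h] on [Z] is at hand: openness is checked on [X], where [h \o p] is regular,
   and descends through the quotient map. *)
have oN u : Fn u -> open [set z | O z /\ u (gr z) != 0].
  move=> [P _ <-]; apply: qp.
  have opO : open (p @^-1` O) by apply: open_comp => // x _; exact: mp.1.
  apply: (floc_open (f := fun x => pfun P (gr (p x)))) lX opO _ => x Ox.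
  apply: (@regular_at_pfun X n P (F \o p) (h \o p)); last exact/rh/OO'.
  by apply: mor_at_comp => //; exact: (imm_mor mF Ox).
have vanish_prime u v : Fn u -> Fn v -> vanish (fun x => u x * v x) ->
    vanish u \/ vanish v.
  move=> Fu Fv uv; apply: contrapT => /not_orP[nu nv].
  have ex w : ~ vanish w -> [set z | O z /\ w (gr z) != 0] !=set0.
    by move=> /existsNP[z /not_implyP[Oz /eqP wz]]; exists z.
  have [z [[Oz uz] [_ vz]]] := iZ _ _ (oN _ Fu) (oN _ Fv) (ex _ nu) (ex _ nv).
  by move/eqP: (uv z Oz); rewrite mulf_eq0 (negbTE uz) (negbTE vz).
(* Some point has all its small neighbourhoods mapped onto dense parts of the graph. If not, every
   point over [O] has a thin neighbourhood; finite unions of thin sets are thin by primality, so the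
   whole preimage of [O] would be thin, contrary to surjectivity of [p]. *)
have [x0 Ox0 x0N] : exists2 x0, O (p x0) & forall N u, open N -> N x0 ->
    N `<=` p @^-1` O -> Fn u -> (forall x, N x -> u (gr (p x)) = 0) -> vanish u.
  apply: contrapT => nx0.
  pose thin (N : set X) := exists u, [/\ Fn u, forall x, N x -> u (gr (p x)) = 0 &
    ~ vanish u].
  have : thin (p @^-1` O).
    apply: noeth_open_ind (noeth_variety vX) _ _ _.
    - exists (fun=> 1); split=> // /(_ z0 Oz0)/eqP; rewrite oner_eq0 //.
    - move=> A B [u [Fu uA nu]] [v [Fv vB nv]]; exists (fun x => u x * v x); split.
      + exact: FnM.
      + by move=> x [/uA ->|/vB ->]; rewrite ?mul0r ?mulr0.
      + by move=> /(vanish_prime _ _ Fu Fv)[].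
    - move=> x Ox; apply: contrapT => nN; apply: nx0; exists x => // N u oN' Nx NO Fu uN.
      by apply: contrapT => nu; apply: nN; exists N; split=> //; exists u.
  move=> [u [Fu uO]]; apply=> z Oz.
  have [x _ xz] : range p z by rewrite sp.
  by rewrite -xz; apply: uO; rewrite /= xz.
pose a (i : 'I_n.+1) : X -> k := fun x => (env (gr (p x)))`_i.
have ra i : regular_at x0 (a i).
  rewrite /a; case: (unliftP ord_max i) => [j|] ->.
    rewrite (_ : (fun _ => _) = fun x => (F (p x) : 'rV[k]_n) ord0 j).
      apply: (@mor_at_coord _ X n (F \o p)); apply: mor_at_comp => //.
      exact: imm_mor Ox0.
    by apply/funext => x; rewrite lift_max env_coord.
  rewrite (_ : (fun _ => _) = h \o p); first exact/rh/OO'.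
  by apply/funext => x; rewrite env_last.
have opO : open (p @^-1` O) by apply: open_comp => // x _; exact: mp.1.
have [N [f [oN' Nx0 NO rf fN]]] := definable_image vX opO Ox0 ra.
pose C : set T := [set gr (p x) | x in N].
have CF u : Fn u -> (forall c, C c -> u c = 0) -> vanish u.
  by move=> Fu uC; apply: (x0N N u) => // x Nx; apply: uC; exists x.
have C0 : C !=set0 by exists (gr (p x0)); exists x0.
have Cpr u v : Fn u -> Fn v -> (forall x, C x -> u x * v x = 0) ->
    (forall x, C x -> u x = 0) \/ (forall x, C x -> v x = 0).
  move=> Fu Fv uv.
  have [uz|vz] := vanish_prime _ _ Fu Fv (CF _ (FnM _ _ Fu Fv) uv).
    by left=> _ [x /NO Ox <-]; exact: uz.
  by right=> _ [x /NO Ox <-]; exact: vz.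
have Cf x : C x -> GRing.holds (env x) f.
  move=> [y Ny <-]; apply/(fN (env (gr (p y)))); first exact: size_env.
  by exists y.
have [g [[Pg _ gE] [c0 Cc0 gc0] gC]] :=
  definable_generic Fn_cst FnD FnM Fn_env C0 Cpr rf Cf.
pose S := set_type O.
pose ev (s : S) : {rmorphism mpoly n k -> k} :=
  meval (fun i => (F (val s) : 'rV[k]_n) ord0 i).
have pvE s P t : pval ev s P t = pfun P (F (val s), t) by [].
pose hS (s : S) := h (val s).
have pvP P : pvanish ev hS P <-> vanish (pfun P).
  split=> [vP z Oz|vP s]; last exact: (vP (val s) (set_valP s)).
  exact: (vP (SigSub (mem_set Oz))).
have [x1 Nx1 c0E] := Cc0.
have Ox1 : O (p x1) by exact: NO.
pose s1 : S := SigSub (mem_set Ox1).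
have [|||b [c [[s2 cs2] bc]]] := @generic_value_rational k (mpoly n k) S ev hS _ Pg s1 k0.
- move=> P Q /pvP PQ; have [|||vP|vP] := @vanish_prime (pfun P) (pfun Q).
  + by exists P.
  + by exists Q.
  + by move=> z Oz; rewrite -pfunM; exact: PQ.
  + by left; apply/pvP.
  + by right; apply/pvP.
- by move: gc0; rewrite -gE -c0E.
(* The point above [s] with last coordinate [t] lies in the closure of [C] and off the zeros of [g],
   so it satisfies [f] and is the graph point of some [p y]; injectivity of the chart gives
   [p y = val s]. *)
- move=> s t sP gs.
  have : GRing.holds (env (F (val s), t)) f.
    apply: gC; last by rewrite -gE.
    by move=> _ [P _ <-] /(CF _ (ex_intro2 _ _ P I erefl))/pvP/sP.
  move=> /(fN _ (size_env _))[y /NO Oy ay].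
  have -> : t = h (p y).
    by have := ay ord_max; rewrite /a !env_last.
  rewrite /hS; congr h; apply: (imm_inj mF) => //; first exact: set_valP.
  apply/rowP => i; have := ay (lift ord_max i).
  by rewrite /a lift_max !env_coord.
exists [set z | O z /\ peval c (F z) != 0]; split.
- apply: floc_open lZ oO _ => z Oz; apply: regular_at_peval => i.
  by apply: mor_at_coord; exact: (imm_mor mF Oz).
- by exists (val s2); split; first exact: set_valP.
- by move=> z [/OO'].
move=> z [Oz cz].
have rF q : regular_at z (fun y => peval q (F y)).
  by apply: regular_at_peval => i; apply: mor_at_coord; exact: (imm_mor mF Oz).
have [cn ci] := lZ _ _ (rF c) cz.
apply: regular_at_near (regular_atM (rF b) ci).
apply: filterS2 (open_near oO Oz) cn => y Oy cy.
by rewrite -(bc (SigSub (mem_set Oy))).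
Qed.

End GenericRegularity.

(** * Comparison of two quotients of one variety *)

Section QuotientComparison.
Context (k : closedFieldType).
Implicit Types X Y Z : fspace k.

Lemma quotient_continuous X Z1 Z2 (p1 : X -> Z1) (p2 : X -> Z2) (phi : Z1 -> Z2) :
  quotient_map p1 -> quotient_map p2 -> (forall x, phi (p1 x) = p2 x) ->
  continuous phi.
Proof.
move=> [_ _ q1] [[c2 _] _ _] phip; apply/continuousP => W oW; apply: q1.
rewrite (_ : _ @^-1` _ = p2 @^-1` W); first by apply: open_comp => // x _; exact: c2.
by apply/funext => x /=; rewrite phip.
Qed.

(** In a chart of [Z2] the coordinates of [phi] pull back along [p1] to coordinates of [p2], which
    are regular. Then [generic_regular] applies to one coordinate after another, shrinking [V] each
    time. *)
Lemma generic_morphism X Z1 Z2 (p1 : X -> Z1) (p2 : X -> Z2) (phi : Z1 -> Z2) :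
    [pchar k] =i pred0 -> is_variety X -> is_variety Z1 -> is_variety Z2 ->
    quotient_map p1 -> quotient_map p2 -> (forall x, phi (p1 x) = p2 x) ->
    irreducible Z1 -> forall z0 : Z1,
  exists V, [/\ open V, V !=set0 & forall z, V z -> mor_at phi z].
Proof.
move=> k0 vX v1 v2 q1 q2 phip i1 z0.
have cphi := quotient_continuous q1 q2 phip.
have [n [O [F [Oz [oO mF _]]]]] := variety_chart v2 (phi z0).
pose c (i : 'I_n) (z : Z1) : k := (F (phi z) : 'rV[k]_n) ord0 i.
have [V [oV V0 VO Vc]] : exists V, [/\ open V, V !=set0, V `<=` phi @^-1` O &
    forall z, V z -> forall i, i \in enum 'I_n -> regular_at z (c i)].
  elim: (enum 'I_n) => [|i s [V [oV V0 VO Vc]]].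
    exists (phi @^-1` O); split=> //; last by exists z0.
    by apply: open_comp => // z _; exact: cphi.
  have [x Vx|W [oW W0 WV Wc]] :=
    @generic_regular k X Z1 p1 V (c i) k0 vX v1 q1 i1 oV V0.
    rewrite (_ : c i \o p1 = fun x => (F (p2 x) : 'rV[k]_n) ord0 i); last first.
      by apply/funext => y; rewrite /= /c phip.
    have [m2 _ _] := q2.
    apply: (@mor_at_coord _ X n (F \o p2)); apply: mor_at_comp.
      exact: ((fmorphismP _).1 m2).
    by apply: (imm_mor mF); rewrite -phip; exact: VO.
  exists W; split=> //; first exact: subset_trans VO.
  move=> z Wz j; rewrite inE => /orP[/eqP->|js]; first exact: Wc.
  by apply: Vc => //; exact: WV.
exists V; split=> // z Vz; split=> [P|f rf]; first exact: cphi.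
have [u Fu fu] := imm_regular mF (VO _ Vz) rf.
have [_ rFphi] : mor_at (F \o phi) z.
  apply: mor_at_affine => [|i]; first exact: (floc_variety v1).
  by have := Vc _ Vz i; apply; rewrite mem_enum.
apply: regular_at_near (rFphi _ Fu).
have fu' : \forall y \near z, f (phi y) = u (F (phi y)) := cphi z _ fu.
by apply: filterS fu' => y /= ->.
Qed.

(** Irreducibility passes to [Z2] through the homeomorphism, so [generic_morphism] applies both
    ways, and the two resulting open sets meet in [Z1]. *)
Lemma generic_isomorphism X Z1 Z2 (p1 : X -> Z1) (p2 : X -> Z2)
    (phi : Z1 -> Z2) (psi : Z2 -> Z1) :
    [pchar k] =i pred0 -> is_variety X -> is_variety Z1 -> is_variety Z2 ->
    quotient_map p1 -> quotient_map p2 -> (forall x, phi (p1 x) = p2 x) ->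
    cancel phi psi -> cancel psi phi -> irreducible Z1 -> forall z0 : Z1,
  exists V, [/\ open V, V !=set0, forall z, V z -> mor_at phi z &
    forall w, V (psi w) -> mor_at psi w].
Proof.
move=> k0 vX v1 v2 q1 q2 phip phiK psiK i1 z0.
have psip x : psi (p2 x) = p1 x by rewrite -phip phiK.
have cphi := quotient_continuous q1 q2 phip.
have cpsi := quotient_continuous q2 q1 psip.
have i2 : irreducible Z2.
  move=> U V oU oV [u Uu] [v Vv].
  have [||||z [Uz Vz]] := i1 (phi @^-1` U) (phi @^-1` V).
  - by apply: open_comp => // z _; exact: cphi.
  - by apply: open_comp => // z _; exact: cphi.
  - by exists (psi u); rewrite /= psiK.
  - by exists (psi v); rewrite /= psiK.
  - by exists (phi z).
have [V1 [oV1 V10 m1]] := generic_morphism k0 vX v1 v2 q1 q2 phip i1 z0.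
have [V2 [oV2 [w V2w] m2]] :=
  generic_morphism k0 vX v2 v1 q2 q1 psip i2 (phi z0).
have oV2' : open (phi @^-1` V2) by apply: open_comp => // z _; exact: cphi.
exists (V1 `&` phi @^-1` V2); split.
- exact: openI.
- by apply: i1 => //; exists (psi w); rewrite /= psiK.
- by move=> z [/m1].
- by move=> w' [_]; rewrite /= psiK => /m2.
Qed.

Definition fres X Y (f : X -> Y) (A : set X) (B : set Y)
    (fAB : forall a, A a -> B (f a)) : subfspace A -> subfspace B :=
  fun a => SigSub (mem_set (fAB _ (set_valP a))).

Lemma val_fres_morphism X Y (f : X -> Y) (A : set X) (B : set Y)
    (g : subfspace A -> subfspace B) : (forall a, val (g a) = f (val a)) ->
  (forall a, A a -> mor_at f a) -> fmorphism g.
Proof.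
move=> gf mf.
suff mfv : fmorphism (f \o val : subfspace A -> Y).
  exact: imm_fmorphism mfv (imm_on_val _) gf.
apply/fmorphismP => a; apply: mor_at_comp.
  by apply: (fmorphismP _).1; exact: fmorphism_val.
exact/mf/set_valP.
Qed.

Lemma fiso_restrict Z1 Z2 (phi : Z1 -> Z2) (psi : Z2 -> Z1) (V : set Z1) :
    cancel phi psi -> cancel psi phi -> (forall z, V z -> mor_at phi z) ->
    (forall w, V (psi w) -> mor_at psi w) ->
  fiso (subfspace V) (subfspace (psi @^-1` V)).
Proof.
move=> phiK psiK m1 m2.
have phiV z : V z -> (psi @^-1` V) (phi z) by rewrite /= phiK.
have psiV w : (psi @^-1` V) w -> V (psi w) by [].
exists (fres phiV), (fres psiV); split.
- exact: (@val_fres_morphism _ _ phi).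
- exact: (@val_fres_morphism _ _ psi).
- by move=> z; apply: val_inj; rewrite /= phiK.
- by move=> w; apply: val_inj; rewrite /= psiK.
Qed.

Lemma quotient_map_restrict X Z (p : X -> Z) (A : set Z) (B : set X)
    (g : subfspace B -> subfspace A) :
    quotient_map p -> closed A -> B = p @^-1` A ->
    (forall a, val (g a) = p (val a)) ->
  quotient_map g.
Proof.
move=> [mp sp qp] cA BE gp; split.
- by apply: val_fres_morphism gp _ => a _; exact: ((fmorphismP _).1 mp).
- apply/seteqP; split=> // z _; have [x _ xz] : range p (val z) by rewrite sp.
  have Bx : B x by rewrite BE /= xz; exact: set_valP.
  by exists (SigSub (mem_set Bx)) => //; apply: val_inj; rewrite gp.
move=> W [N oN NW].
(* Adding the complement of the closed set [A] to [W] gives an open preimage in all of [X], to which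
   the quotient property of [p] applies. *)
have oW : open (val @` W `|` ~` A : set Z).
  apply: qp; rewrite (_ : _ @^-1` _ = N `|` ~` B).
    apply: openU => //; apply: closed_openC; rewrite BE.
    rewrite -[A]setCK -preimage_setC; apply: open_closedC.
    by apply: open_comp (closed_openC cA) => x _; exact: (mp.1 x).
  have NWE x (Bx : B x) : N x = W (g (SigSub (mem_set Bx))).
    by rewrite -[RHS]/((g @^-1` W) (SigSub (mem_set Bx))) -NW.
  apply/seteqP; split=> x /=.
    move=> [[w Ww wx]|nA]; last by right; rewrite BE.
    have Bx : B x by rewrite BE /= -wx; exact: set_valP.
    left; rewrite (NWE x Bx); suff -> : g (SigSub (mem_set Bx)) = w by [].
    by apply: val_inj; rewrite gp; exact: esym wx.
  have [Bx|nBx] := pselect (B x); last by move=> _; right; rewrite BE in nBx.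
  rewrite (NWE x Bx) => -[Wx|//]; left.
  by exists (g (SigSub (mem_set Bx))) => //; rewrite gp.
exists (val @` W `|` ~` A) => //; apply/seteqP; split=> z /=.
  by move=> [[w Ww /val_inj <-]//|]; case; exact: set_valP.
by move=> Wz; left; exists z.
Qed.

End QuotientComparison.
(** * Classes of locally closed subsets *)

Section Classes.
Context (k : closedFieldType).
Implicit Types Q : fspace k.

(* The class of a subset, with junk value [0] when it is not a variety. *)
Definition subclass Q (A : set Q) : KVar k :=
  if pselect (is_variety (subfspace A)) is left vA then kvar (Variety vA)
  else KVar0 k.

Lemma subclassE Q (A : set Q) (V : variety k) : is_variety (subfspace A) ->
  fiso V (subfspace A) -> subclass A = kvar V.
Proof.
move=> vA VA; rewrite /subclass; case: pselect => // vA'.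
by apply/kclassP/kcong_iso; exact: fiso_sym.
Qed.

Lemma subclass_fiso Q1 Q2 (A : set Q1) (B : set Q2) : is_variety (subfspace A) ->
  is_variety (subfspace B) -> fiso (subfspace A) (subfspace B) ->
  subclass A = subclass B.
Proof.
move=> vA vB AB; rewrite (subclassE (V := Variety vB)) //.
  by rewrite (subclassE (V := Variety vB)) //; exact: fiso_refl.
exact: fiso_sym.
Qed.

Lemma fiso_trans Q2 Q1 Q3 : fiso Q1 Q2 -> fiso Q2 Q3 -> fiso Q1 Q3.
Proof.
move=> [f [g [mf mg fK gK]]] [f' [g' [mf' mg' fK' gK']]].
exists (f' \o f), (g \o g'); split; try exact: fmorphism_comp.
  exact: can_comp.
exact: can_comp.
Qed.

Lemma fiso_setT Q : fiso Q (subfspace (setT : set Q)).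
Proof.
apply: (@imm_val_eq k Q Q id); last by apply/seteqP; split=> // x _; exists x.
by apply: (@imm_on_fiso _ _ _ id id) => //; exact: fmorphism_id.
Qed.

Lemma fiso_sub_sub Q (A : set Q) (B : set (subfspace A)) (C : set Q) :
  (forall a : subfspace A, B a <-> C (val a)) -> C `<=` A ->
  fiso (subfspace B) (subfspace C).
Proof.
move=> BC CA; apply: (@imm_val_eq k (subfspace B) Q
    ((val : subfspace A -> Q) \o (val : subfspace B -> subfspace A))).
  by apply: imm_on_comp (imm_on_val B) (imm_on_val A) _.
apply/seteqP; split=> [_ [b _ <-]|x Cx].
  by apply/BC; exact: (set_valP b).
have Ba : B (SigSub (mem_set (CA x Cx))) by apply/BC.
by exists (SigSub (mem_set Ba)).
Qed.

Definition locally_closed Q (A : set Q) : Prop :=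
  exists O C, [/\ open O, closed C & A = O `&` C].

Lemma locally_closedI Q (A B : set Q) :
  locally_closed A -> locally_closed B -> locally_closed (A `&` B).
Proof.
move=> [O [C [oO cC ->]]] [O' [C' [oO' cC' ->]]].
exists (O `&` O'), (C `&` C'); split; [exact: openI|exact: closedI|].
by rewrite setIACA.
Qed.

Lemma locally_closed_open Q (A : set Q) : open A -> locally_closed A.
Proof. by exists A, setT; split=> //; rewrite setIT. Qed.

Lemma locally_closed_closed Q (A : set Q) : closed A -> locally_closed A.
Proof. by exists setT, A; split; rewrite ?setTI //; exact: openT. Qed.

Lemma is_variety_locally_closed Q (A : set Q) : is_variety Q -> locally_closed A ->
  is_variety (subfspace A).
Proof. by move=> vQ [O [C [oO cC ->]]]; exact: is_variety_sub. Qed.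

(** The scissor relation is applied inside the variety [A], and nested subspaces are identified with
    subsets of [Q]. *)
Lemma subclass_scissor Q (A B : set Q) : is_variety Q -> locally_closed A ->
  closed B -> subclass A = KVar_add (subclass (A `&` B)) (subclass (A `&` ~` B)).
Proof.
move=> vQ lA cB; have vA := is_variety_locally_closed vQ lA.
have vAB : is_variety (subfspace (A `&` B)).
  apply: is_variety_locally_closed => //; apply: locally_closedI => //.
  exact: locally_closed_closed.
have vAC : is_variety (subfspace (A `&` ~` B)).
  apply: is_variety_locally_closed => //; apply: locally_closedI => //.
  by apply: locally_closed_open; exact: closed_openC.
rewrite (subclassE (V := Variety vA)) //; last exact: fiso_refl.
rewrite (subclassE (V := Variety vAB)) //; last exact: fiso_refl.
rewrite (subclassE (V := Variety vAC)) //; last exact: fiso_refl.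
rewrite /kvar -kclassD; apply/kclassP.
pose B' : set (subfspace A) := val @^-1` B.
apply: (@kcong_scissor k (Variety vA) (Variety vAB) (Variety vAC) B').
- rewrite /B' -[B]setCK -preimage_setC; apply: open_closedC.
  apply: open_comp (closed_openC cB) => x _.
  exact: ((fmorphism_val A).1 x).
- apply/fiso_sym/fiso_sub_sub => [a|x []//].
  by split=> [Ba|[]//]; split=> //; exact: set_valP.
- apply/fiso_sym/fiso_sub_sub => [a|x []//].
  by split=> [Ba|[]//]; split=> //; exact: set_valP.
Qed.

Lemma KVar_addI (x : KVar k) : injective (KVar_add x).
Proof.
move=> y z /(congr1 (KVar_add (KVar_opp x))).
by rewrite !KVar_addA !KVar_addN !KVar_add0.
Qed.

Lemma kvar_setT (Q : variety k) : kvar Q = subclass (setT : set Q).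
Proof.
rewrite (subclassE (V := Q)) //; last exact: fiso_setT.
by apply: is_variety_open (varietyP Q) openT.
Qed.

Lemma reducible_closed Q (A : set Q) : ~ irreducible (subfspace A) ->
  exists U V, [/\ open U, open V, A `&` U !=set0, A `&` V !=set0 &
    A `&` U `&` V = set0].
Proof.
move=> nA; apply: contrapT => nUV; apply: nA => _ _ [U oU <-] [V oV <-].
move=> [u Uu] [v Vv]; apply: contrapT => UV; apply: nUV; exists U, V; split=> //.
- by exists (val u); split=> //; exact: set_valP.
- by exists (val v); split=> //; exact: set_valP.
- rewrite -subset0 => x [[Ax Ux] Vx]; apply: UV.
  by exists (SigSub (mem_set Ax)).
Qed.

(* Noetherian induction: an irreducible closed set is split by the open set on
   which the bijection is an isomorphism, a reducible one by one of its proper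
   closed subsets. *)
Lemma subclass_quotient (X Q1 Q2 : fspace k) (p1 : X -> Q1) (p2 : X -> Q2)
    (phi : Q1 -> Q2) (psi : Q2 -> Q1) :
    [pchar k] =i pred0 -> is_variety X -> is_variety Q1 -> is_variety Q2 ->
    quotient_map p1 -> quotient_map p2 -> (forall x, phi (p1 x) = p2 x) ->
    cancel phi psi -> cancel psi phi ->
  forall A, closed A -> subclass A = subclass (psi @^-1` A).
Proof.
move=> k0 vX v1 v2 q1 q2 phip phiK psiK.
have psip x : psi (p2 x) = p1 x by rewrite -phip phiK.
have cpsi := quotient_continuous q2 q1 psip.
have opsi O : open O -> open (psi @^-1` O).
  by move=> oO; apply: open_comp => // z _; exact: cpsi.
have clpsi C : closed C -> closed (psi @^-1` C).
  move=> cC; rewrite -[C]setCK -preimage_setC; apply: open_closedC.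
  exact: (opsi (~` C) (closed_openC cC)).
have scissor2 B C : locally_closed (psi @^-1` B) -> closed C ->
    subclass (psi @^-1` B) = KVar_add (subclass (psi @^-1` (B `&` C)))
      (subclass (psi @^-1` (B `&` ~` C))).
  by move=> lB cC; exact: subclass_scissor v2 lB (clpsi _ cC).
apply: noeth_closed_ind (noeth_variety v1) _ => A cA IHA.
have lA := locally_closed_closed cA.
have lA' := locally_closed_closed (clpsi _ cA).
have vA := is_variety_closed v1 cA.
have vA' := is_variety_closed v2 (clpsi _ cA).
(* The empty set is treated apart, since the generic isomorphism starts from a point. *)
have [A0|/set0P[z0 Az0]] := eqVneq A set0.
  apply: subclass_fiso => //; rewrite A0.
  have f1 : subfspace (set0 : set Q1) -> subfspace (psi @^-1` set0).
    by move=> z; case: (set_valP z).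
  have f2 : subfspace (psi @^-1` set0) -> subfspace (set0 : set Q1).
    by move=> z; case: (set_valP z).
  exists f1, f2; split; try (by move=> z; case: (set_valP z)).
    by apply/fmorphismP => z; case: (set_valP z).
  by apply/fmorphismP => z; case: (set_valP z).
have [iA|/reducible_closed[U [V [oU oV [u [Au Uu]] [v [Av Vv]] UV]]]] :=
  pselect (irreducible (subfspace A)); last first.
  have cU := open_closedC oU; have cV := open_closedC oV.
  (* Inside [A] the sets [U] and [V] are disjoint, so the part of [A] in [U] is also the part of [A]
     minus [V] in [U]. Its class follows by cancellation from those of proper closed subsets. *)
  have AUE : A `&` ~` ~` U = (A `&` ~` V) `&` ~` ~` U.
    rewrite setCK; apply/seteqP; split=> [x [Ax Ux]|x [[Ax _] Ux]] //.
    split=> //; split=> // Vx; have : (A `&` U `&` V) x by [].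
    by rewrite UV.
  have IH1 : subclass (A `&` ~` U) = subclass (psi @^-1` (A `&` ~` U)).
    by apply: IHA => [|x []//|/(_ u Au)[]//]; exact: closedI.
  have IH2 : subclass (A `&` ~` V) = subclass (psi @^-1` (A `&` ~` V)).
    by apply: IHA => [|x []//|/(_ v Av)[]//]; exact: closedI.
  have IH3 : subclass (A `&` ~` V `&` ~` U) =
      subclass (psi @^-1` (A `&` ~` V `&` ~` U)).
    apply: IHA => [|x [[]]//|/(_ v Av)[[]]//].
    by apply: closedI => //; exact: closedI.
  have cAV : closed (A `&` ~` V) by exact: closedI.
  rewrite (subclass_scissor v1 lA cU) (scissor2 _ _ lA' cU) AUE IH1.
  congr KVar_add.
  have := subclass_scissor v1 (locally_closed_closed cAV) cU.
  rewrite IH2 (scissor2 _ _ (locally_closed_closed (clpsi _ cAV)) cU) IH3.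
  by move/KVar_addI.
(* Both quotient maps restrict to the closed subset of [X] above [A], so the generic isomorphism
   applies to [A] itself. *)
have p1A : forall x, (p1 @^-1` A) x -> A (p1 x) by [].
have p2A : forall x, (p1 @^-1` A) x -> (psi @^-1` A) (p2 x).
  by move=> x; rewrite /= psip.
have phiA : forall z, A z -> (psi @^-1` A) (phi z) by move=> z; rewrite /= phiK.
have psiA : forall w, (psi @^-1` A) w -> A (psi w) by [].
have cp1A : closed (p1 @^-1` A).
  rewrite -[A]setCK -preimage_setC; apply: open_closedC.
  have [m1 _ _] := q1.
  by apply: open_comp (closed_openC cA) => x _; exact: (m1.1 x).
have vXA := is_variety_closed vX cp1A.
have [|||||V [oV [v Vv] mphi mpsi]] :=
  @generic_isomorphism k _ _ _ (fres p1A) (fres p2A) (fres phiA) (fres psiA)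
    k0 vXA vA vA' _ _ _ _ _ iA (SigSub (mem_set Az0)).
- exact: (quotient_map_restrict q1 cA).
- apply: (quotient_map_restrict q2 (clpsi _ cA)) => //.
  by apply/seteqP; split=> x /=; rewrite psip.
- by move=> x; apply: val_inj; rewrite /= phip.
- by move=> z; apply: val_inj; rewrite /= phiK.
- by move=> z; apply: val_inj; rewrite /= psiK.
(* The closed part of [A] outside [O] is proper because it misses [v]; on the part inside [O] the
   bijection is an isomorphism. *)
have [O oO OV] := oV; have cO := open_closedC oO.
rewrite (subclass_scissor v1 lA cO) (scissor2 _ _ lA' cO) !setCK.
congr KVar_add.
  apply: IHA => [|x []//|]; first exact: closedI.
  move=> /(_ _ (set_valP v))[_]; apply.
  by rewrite -OV in Vv.
have lAO : locally_closed (A `&` O).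
  by apply: locally_closedI => //; exact: locally_closed_open.
have lAO' : locally_closed (psi @^-1` (A `&` O)).
  rewrite preimage_setI; apply: locally_closedI => //.
  by apply: locally_closed_open; exact: opsi.
apply: subclass_fiso; try exact: is_variety_locally_closed.
have VO z : V z <-> O (val z) by rewrite -OV.
apply: (@fiso_trans (subfspace V)).
  apply/fiso_sym/fiso_sub_sub => [z|x []//].
  by rewrite VO; split=> [Oz|[]//]; split=> //; exact: set_valP.
apply: (@fiso_trans (subfspace (fres psiA @^-1` V))).
  apply: fiso_restrict mphi mpsi => z; apply: val_inj => /=.
    by rewrite phiK.
  by rewrite psiK.
apply: fiso_sub_sub => [z|x []//].
rewrite /preimage /= VO; split=> [Oz|[]//]; split=> //.
exact: (set_valP z).
Qed.

End Classes.
Lemma complementE (T : Type) (A B : set T) :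
  A `|` B = setT -> A `&` B = set0 -> B = ~` A.
Proof.
move=> ABT AB0; apply/seteqP; split=> [x Bx Ax|x nAx].
  suff : set0 x by []; by rewrite -AB0.
by have [/nAx|] : (A `|` B) x by rewrite ABT.
Qed.

(** * Pseudo-quotients *)

Section PseudoQuotients.
Context (k : closedFieldType) (G : alg_group k).
Implicit Types X Q : fspace k.

Lemma act_continuous X (act : G -> X -> X) g : floc X -> is_action act ->
  continuous (act g).
Proof.
move=> lX [[cact _] _ _]; apply/continuousP => W oW.
apply: (@open_slice k G X ((fun z : prod_fspace G X => act z.1 z.2) @^-1` W) g) => //.
by apply: open_comp => // z _; exact: cact.
Qed.

Lemma ginvariant_closure X (act : G -> X -> X) (W : set X) : floc X ->
  is_action act -> ginvariant act W -> ginvariant act (closure W).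
Proof.
move=> lX aX iW g x Wx N gN; have [y [Wy Ny]] := Wx _ (act_continuous lX aX gN).
by exists (act g y); split=> //; exact: iW.
Qed.

Lemma ginvariant_orbit X (act : G -> X -> X) x : is_action act ->
  ginvariant act (gorbit act x).
Proof. by move=> [_ _ actM] g _ [h _ <-]; exists (gmul g h). Qed.

Lemma orbit_refl X (act : G -> X -> X) x : is_action act -> gorbit act x x.
Proof. by move=> [_ act1 _]; exists (gone G). Qed.

Section Quotient.
Context (X Q : fspace k) (act : G -> X -> X) (p : X -> Q).
Hypothesis pq : pseudo_quotient act p.

Lemma closed_fibre z : closed (p @^-1` [set z]).
Proof.
have [vQ [cp _] _ _ _] := pq.
rewrite -[[set z]]setCK -preimage_setC; apply: open_closedC.
by apply: open_comp (closed_openC (closed_point vQ (x := z))) => x _; exact: cp.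
Qed.

Lemma ginvariant_preimage (B : set Q) : ginvariant act (p @^-1` B).
Proof. by have [_ _ _ pact _] := pq => g x /=; rewrite pact. Qed.

(* A fibre disjoint from [W] is closed and invariant, so its image is not in
   the closure of the image of [W]. *)
Lemma closed_ginvariant_image (W : set X) : closed W -> ginvariant act W ->
  closed (p @` W).
Proof.
move=> cW iW z zW; have [_ _ pS _ dp] := pq; apply: contrapT => nz.
have [x _ xz] : range p z by rewrite pS.
have : closure (p @` W) `&` closure (p @` (p @^-1` [set z])) = set0.
  apply: dp => //; [exact: closed_fibre|exact: ginvariant_preimage|].
  by rewrite -subset0 => y [Wy yz]; apply: nz; exists y.
rewrite -subset0; apply; split; first exact: zW.
by apply: subset_closure; exists x.
Qed.

(** The preimage of the complement of [W] is closed and invariant, so its image, which is that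
    complement, is closed. *)
Lemma pseudo_quotient_map : quotient_map p.
Proof.
have [vQ mp pS pact _] := pq; split=> // W oW.
have -> : W = ~` (p @` (p @^-1` (~` W))).
  by rewrite image_preimage // setCK.
apply: closed_openC; apply: closed_ginvariant_image.
  by rewrite -preimage_setC; exact: open_closedC.
exact: ginvariant_preimage.
Qed.

(** Saturation puts the fibres over the image of [A] inside [A], so separation reduces to the
    separation property of [p] on a single fibre; local closedness makes the image a variety. *)
Lemma restr_pseudo_quotient (A : set X) (iA : ginvariant act A) : floc X ->
    is_action act -> p @^-1` (p @` A) = A -> locally_closed (p @` A) ->
  pseudo_quotient (restr_act iA) (@restr_image k X Q p A).
Proof.
move=> lX aX sA lA; have [vQ mp pS pact dp] := pq.
have mr : fmorphism (@restr_image k X Q p A).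
  apply: (@val_fres_morphism k X Q p) => // a _; exact: ((fmorphismP _).1 mp).
split=> //.
- exact: is_variety_locally_closed.
- apply/seteqP; split=> // z _; have [x Ax xz] := set_valP z.
  by exists (SigSub (mem_set Ax)) => //; apply: val_inj; rewrite /= xz.
- by move=> g x; apply: val_inj; rewrite /= pact.
have traceE (W : set (subfspace A)) : closed W ->
    closure (val @` W : set X) `&` A = val @` W.
  move=> cW; apply/seteqP; split=> [x [Wx Ax]|_ [a Wa <-]]; last first.
    by split; [apply: subset_closure; exists a|exact: set_valP].
  exists (SigSub (mem_set Ax)) => //; apply: cW => N.
  have [_ _ nv _] := imm_on_val A.
  move=> /(nv (SigSub (mem_set Ax)) _ I)/Wx[_ [[a Wa <-] /(_ a I erefl) Na]].
  by exists a.
have inv (W : set (subfspace A)) : ginvariant (restr_act iA) W ->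
    ginvariant act (val @` W).
  by move=> iW g _ [a Wa <-]; exists (restr_act iA g a) => //; exact: iW.
have fibreA z : (p @` A) z -> p @^-1` [set z] `<=` A.
  by move=> Az x xz; rewrite -sA /= xz.
(* If the fibre over [z] missed [W], it would also miss the closure of [W] in [X], whose trace on
   [A] is [W]; separation would then keep [z] out of the closure of the image. *)
have meets (W : set (subfspace A)) z : closed W -> ginvariant (restr_act iA) W ->
    (p @` A) z -> closure (p @` (val @` W)) z -> exists2 a, W a & p (val a) = z.
  move=> cW iW Az Wz; apply: contrapT => nW.
  have : closure (p @` closure (val @` W : set X)) `&`
      closure (p @` (p @^-1` [set z])) = set0.
    apply: dp.
    - exact: closed_closure.
    - exact: closed_fibre.
    - by apply: ginvariant_closure => //; exact: inv.
    - exact: ginvariant_preimage.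
    rewrite -subset0 => x [Wx xz].
    have : (val @` W) x by rewrite -(traceE _ cW); split=> //; exact: fibreA xz.
    by move=> [a Wa ax]; apply: nW; exists a => //; rewrite ax.
  rewrite -subset0; apply; split.
    by apply: closureS Wz; apply: image_subset; exact: subset_closure.
  have [x Ax xz] := Az; apply: subset_closure.
  by exists x.
have cimage (W : set (subfspace A)) b : closure (@restr_image k X Q p A @` W) b ->
    closure (p @` (val @` W)) (val b).
  move=> Wb N /(sub_near (a := b))/Wb[_ [[a Wa <-] Na]].
  by exists (p (val a)); split=> //; exists (val a) => //; exists a.
move=> W1 W2 cW1 cW2 iW1 iW2 W12; rewrite -subset0 => b [/cimage b1 /cimage b2].
have Ab : (p @` A) (val b) := set_valP b.
have [a1 Wa1 pa1] := meets _ _ cW1 iW1 Ab b1.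
have [a2 Wa2 pa2] := meets _ _ cW2 iW2 Ab b2.
(* The part of [W] in the fibre over [val b], written so as to be visibly closed in [X]. For [W1]
   and [W2] these parts are disjoint, yet both map onto [val b]. *)
pose F (W : set (subfspace A)) := closure (val @` W : set X) `&` p @^-1` [set val b].
have cF W : closed (F W) by apply: closedI; [exact: closed_closure|exact: closed_fibre].
have iF W : ginvariant (restr_act iA) W -> ginvariant act (F W).
  move=> iW g x [Wx xb]; split; last exact: ginvariant_preimage.
  by apply: ginvariant_closure => //; exact: inv.
have FW W x : closed W -> F W x -> exists2 a, W a & val a = x.
  move=> cW [Wx xb]; have : (closure (val @` W : set X) `&` A) x.
    by split=> //; exact: fibreA xb.
  by rewrite traceE // => -[a Wa ax]; exists a.
have : closure (p @` F W1) `&` closure (p @` F W2) = set0.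
  apply: dp => //; [exact: iF|exact: iF|].
  rewrite -subset0 => x [/(FW _ _ cW1)[c1 Wc1 <-] /(FW _ _ cW2)[c2 Wc2 /val_inj c21]].
  suff : (W1 `&` W2) c1 by rewrite W12.
  by split=> //; rewrite -c21.
rewrite -subset0 => /(_ (val b)); apply; split; apply: subset_closure.
  by exists (val a1) => //; split=> //; apply: subset_closure; exists a1.
by exists (val a2) => //; split=> //; apply: subset_closure; exists a2.
Qed.

Lemma orbitwise_closed_image (Y U : set X) : floc X -> is_action act ->
    closed Y -> ginvariant act Y -> Y `|` U = setT -> Y `&` U = set0 ->
    orbitwise_closed act U ->
  [/\ p @` Y `|` p @` U = setT, p @` Y `&` p @` U = set0,
        open (p @` U) & closed (p @` Y)].
Proof.
move=> lX aX cY iY YUT YU0 oU; have [vQ mp pS pact dp] := pq.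
have cpY : closed (p @` Y) by exact: closed_ginvariant_image.
have pYUT : p @` Y `|` p @` U = setT by rewrite -image_setU YUT.
have pYU0 : p @` Y `&` p @` U = set0.
  rewrite -subset0 => z [Yz [u Uu uz]]; rewrite -uz in Yz.
  have : closure (p @` Y) `&` closure (p @` closure (gorbit act u)) = set0.
    apply: dp => //; first exact: closed_closure.
      by apply: ginvariant_closure => //; exact: ginvariant_orbit.
    by rewrite -subset0 => x [Yx /(oU u Uu) Ux]; rewrite -YU0.
  rewrite -subset0 => /(_ (p u)); apply; split; apply: subset_closure => //.
  by exists u => //; apply: subset_closure; exact: orbit_refl.
by split=> //; rewrite (complementE pYUT pYU0); exact: closed_openC.
Qed.

End Quotient.

(** Two distinct fibres of [p2] are disjoint, closed and invariant, so [p1] sends them to disjoint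
    sets. *)
Lemma pseudo_quotient_fibre X Q1 Q2 (act : G -> X -> X) (p1 : X -> Q1)
    (p2 : X -> Q2) : pseudo_quotient act p1 -> pseudo_quotient act p2 ->
  forall x y, p1 x = p1 y -> p2 x = p2 y.
Proof.
move=> pq1 pq2 x y xy; apply: contrapT => nxy; have [_ _ _ _ dp1] := pq1.
have : closure (p1 @` (p2 @^-1` [set p2 x])) `&`
    closure (p1 @` (p2 @^-1` [set p2 y])) = set0.
  apply: dp1; try exact: (closed_fibre pq2).
  - exact: (ginvariant_preimage pq2).
  - exact: (ginvariant_preimage pq2).
  by rewrite -subset0 => z [/= zx zy]; apply: nxy; rewrite -zx -zy.
rewrite -subset0 => /(_ (p1 x)); apply; split; apply: subset_closure.
  by exists x.
by exists y.
Qed.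

(** Equality of fibres gives mutually inverse maps between the quotients; [subclass_quotient] is
    then applied to the whole of [Q1]. *)
Lemma kvar_pseudo_quotient X (Q1 Q2 : variety k) (act : G -> X -> X)
    (p1 : X -> Q1) (p2 : X -> Q2) : [pchar k] =i pred0 -> is_variety X ->
  pseudo_quotient act p1 -> pseudo_quotient act p2 -> kvar Q1 = kvar Q2.
Proof.
move=> k0 vX pq1 pq2.
have lift (R1 R2 : variety k) (r1 : X -> R1) (r2 : X -> R2) :
    pseudo_quotient act r1 -> pseudo_quotient act r2 ->
    exists f : R1 -> R2, forall x, f (r1 x) = r2 x.
  move=> rq1 rq2; have /choice[f fP] : forall z, exists w, forall x, r1 x = z -> r2 x = w.
    move=> z; have [_ _ rS _ _] := rq1; have [y _ <-] : range r1 z by rewrite rS.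
    by exists (r2 y) => x; exact: pseudo_quotient_fibre rq1 rq2 x y.
  by exists f => x; rewrite -(fP _ x).
have [phi phip] := lift _ _ _ _ pq1 pq2; have [psi psip] := lift _ _ _ _ pq2 pq1.
have [_ _ p1S _ _] := pq1; have [_ _ p2S _ _] := pq2.
rewrite !kvar_setT.
apply: (subclass_quotient (phi := phi) (psi := psi) k0 vX (varietyP Q1)
  (varietyP Q2) (pseudo_quotient_map pq1) (pseudo_quotient_map pq2) phip).
- move=> z; have [x _ <-] : range p1 z by rewrite p1S.
  by rewrite phip psip.
- move=> z; have [x _ <-] : range p2 z by rewrite p2S.
  by rewrite psip phip.
- exact: closedT.
Qed.

End PseudoQuotients.

(** * Decomposition of the quotient and of its class *)

Theorem theorem5p5 (k : closedFieldType) (G : alg_group k) (X : variety k)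
    (act : G -> X -> X) (Y U : set X)
    (act_action : is_action act)
    (Y_closed : closed Y) (U_open : open U)
    (YUT : Y `|` U = setT) (YU0 : Y `&` U = set0)
    (U_orb : orbitwise_closed act U) :
  let U_inv := orbitwise_closed_ginvariant U_orb in
  let Y_inv := complement_ginvariant act_action YUT YU0 U_inv in
  (forall (Q : variety k) (p : X -> Q), pseudo_quotient act p ->
    [/\ p @` Y `|` p @` U = setT, p @` Y `&` p @` U = set0,
        open (p @` U) & closed (p @` Y)] /\
    pseudo_quotient (restr_act U_inv) (@restr_image k X Q p U) /\
    pseudo_quotient (restr_act Y_inv) (@restr_image k X Q p Y)) /\
  ([pchar k] =i pred0 ->
    forall (Q : variety k) (p : X -> Q), pseudo_quotient act p ->
    forall (QY : variety k) (pY : subfspace Y -> QY),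
      pseudo_quotient (restr_act Y_inv) pY ->
    forall (QU : variety k) (pU : subfspace U -> QU),
      pseudo_quotient (restr_act U_inv) pU ->
    kvar Q = KVar_add (kvar QY) (kvar QU)).
Proof.
move=> U_inv Y_inv.
have lX := floc_variety (varietyP X).
have part1 (Q : variety k) (p : X -> Q) : pseudo_quotient act p ->
    [/\ p @` Y `|` p @` U = setT, p @` Y `&` p @` U = set0,
        open (p @` U) & closed (p @` Y)] /\
    pseudo_quotient (restr_act U_inv) (@restr_image k X Q p U) /\
    pseudo_quotient (restr_act Y_inv) (@restr_image k X Q p Y).
  move=> pq; have im := orbitwise_closed_image pq lX act_action Y_closed Y_inv
    YUT YU0 U_orb; have [pYUT pYU0 opU cpY] := im; split=> //.
  have YorU x : Y x \/ U x by have : (Y `|` U) x by rewrite YUT.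
  have disj x y : Y x -> U y -> p x <> p y.
    move=> Yx Uy xy; have : (p @` Y `&` p @` U) (p x).
      by split; [exists x|exists y].
    by rewrite pYU0.
  split; apply: restr_pseudo_quotient => //.
  - apply/seteqP; split=> [x [u Uu ux]|x Ux]; last by exists x.
    by have [Yx|//] := YorU x; case: (disj _ _ Yx Uu).
  - exact: locally_closed_open.
  - apply/seteqP; split=> [x [y Yy yx]|x Yx]; last by exists x.
    by have [//|Ux] := YorU x; case: (disj _ _ Yy Ux).
  - exact: locally_closed_closed.
split=> // k0 Q p pq QY pY pqY QU pU pqU.
have [[pYUT pYU0 opU cpY] [rU rY]] := part1 Q p pq.
have vQ := varietyP Q.
have vY := is_variety_closed (varietyP X) Y_closed.
have vU := is_variety_open (varietyP X) U_open.
(* Cutting [Q] along the closed image of [Y] leaves the image of [U]; the restricted maps are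
   pseudo-quotients of [Y] and [U], so the pieces have the classes of [QY] and [QU]. *)
rewrite kvar_setT (subclass_scissor vQ (locally_closed_closed closedT) cpY).
rewrite !setTI -(complementE pYUT pYU0); congr KVar_add.
  rewrite (subclassE (V := Variety (is_variety_closed vQ cpY))); last 2 first.
  - exact: is_variety_closed.
  - exact: fiso_refl.
  exact: (@kvar_pseudo_quotient k G (subfspace Y) (Variety _) QY _ _ _ k0 vY rY pqY).
rewrite (subclassE (V := Variety (is_variety_open vQ opU))); last 2 first.
- exact: is_variety_open.
- exact: fiso_refl.
exact: (@kvar_pseudo_quotient k G (subfspace U) (Variety _) QU _ _ _ k0 vU rU pqU).
Qed.
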